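(* Fix $(j,i)$ with $0\le j<q$, $0\le i<p$, and put $s=s_{j,i}$. Suppose that $\mathcal R_{j,i}$ is represented by a finite complex measure $\mathrm d\rho_{j,i}$ supported on $[0,R_0]$. The linear functional $\widehat\Psi_{j,i}$ is represented by a finite complex measure on $\Sigma_M^{[R_0]}=\bigcup_{r=0}^{M-1}\zeta_M^r[0,R_0^{1/M}]$ if and only if, when $s>0$, $\rho_{j,i}(\{0\})=0$ and \[ \int_{(0,R_0]}x^{-s/M}\,\mathrm d|\rho_{j,i}|(x)<\infty . \] When these conditions hold, one such representing measure $\mathrm d\widehat\rho_{j,i}$ is defined by \[ \int_{\Sigma_M^{[R_0]}}f(\lambda)\,\mathrm d\widehat\rho_{j,i}(\lambda)=\frac1M\sum_{r=0}^{M-1}\zeta_M^{-rs}\int_{(0,R_0]}f\bigl(\zeta_M^rx^{1/M}\bigr)x^{-s/M}\,\mathrm d\rho_{j,i}(x) \] (when $s=0$, an atom of $\rho_{j,i}$ at the origin is included on the right-hand side, i.e. the integral is over $[0,R_0]$). Then $\mathrm d\widehat\rho_{j,i}$ is a finite complex measure and \[ \int_{\Sigma_M^{[R_0]}}\lambda^n\,\mathrm d\widehat\rho_{j,i}(\lambda)=\begin{cases}\mathcal R_{j,i}(x^k),&n=s+Mk,\\0,&n\not\equiv s\pmod M.\end{cases} \] Its Cauchy transform is \[ \int_{\Sigma_M^{[R_0]}}\frac{\mathrm d\widehat\rho_{j,i}(\zeta)}{\lambda-\zeta}=\lambda^{M-s-1}\int_{[0,R_0]}\frac{\mathrm d\rho_{j,i}(x)}{\lambda^M-x},\qquad\lambda\in\mathbb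 C\setminus\Sigma_M^{[R_0]}. \]
   Context: Let $p,q\ge1$, $M=p+q$, $d=\gcd(p,q)$, $P=p/d$, $Q=q/d$, $R=P+Q$, $\zeta_M=\exp(2\pi\mathrm i/M)$. Matrices are semi-infinite. A lower bidiagonal $L$ is normalized if $L_{n,n}=1$, an upper bidiagonal $U$ is normalized if $U_{n,n+1}=1$; positive means that the remaining entries ($L_{n+1,n}$, resp. $U_{n,n}$) are all $>0$. Let $T=L_1\cdots L_pU_q\cdots U_1$ with all factors normalized positive; $F_a=L_a$ ($1\le a\le p$), $F_{p+b}=U_{q-b+1}$ ($1\le b\le q$). Fix $a\in\mathcal A_{\mathrm{cyc}}=\{a_-,\dots,a_+\}$, $a_-=p-\lceil P/Q\rceil+1$, $a_+=p+1+\min\{q-1,\lceil Q/P\rceil\}$. Let $r_k$ be the remainder of $kQ$ mod $R$ and $\sigma_{\mathrm{min}}$ the word of length $M$ whose $(k+1)$-st letter is $L$ if $r_k<P$ and $U$ otherwise. Finitely many replacements of a neighbouring pair $U,L$ (upper before lower) by the unique normalized positive pair $\widetilde L,\widetilde U$ with $UL=\widetilde L\widetilde U$ transform $(F_a,\dots,F_M,F_1,\dots,F_{a-1})$ into a list $(\widetilde F^{(a)}_1,\dots,\widetilde F^{(a)}_M)$ of normalized positive bidiagonal factors with type word $\sigma_{\mathrm{min}}$ (independent of the choices). Matrix $\mathscr H_{(a)}$: put $\widetilde\omega_j=r_{j-1}$. Rows and columns (''states'') are indexed by pairs $(h,j)$, $h\in\mathbb N_0$, $j\in\{1,\dots,M\}$,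 $h-\widetilde\omega_j\in R\mathbb N_0$, ordered by $h$ and then by $j$ (the factor-position label); $n=(h-\widetilde\omega_j)/R$; $j^+=j+1$ for $j<M$, $M^+=1$. Nonzero entries: $1$ at row $(h,j)$, column $(h+Q,j^+)$; at row $(h,j)$, column $(h-P,j^+)$, the entry $(\widetilde F^{(a)}_j)_{n,n-1}$ if $\widetilde F_j^{(a)}$ is lower and $n\ge1$, and $(\widetilde F^{(a)}_j)_{n,n}$ if $\widetilde F^{(a)}_j$ is upper. Let $b_0,\dots,b_{q-1}$ be the first $q$ states and $c_0,\dots,c_{p-1}$ the first $p$ states, with factor-position labels $a(b_j)$, $a(c_i)$. The linear functional $\widehat\Psi_{j,i}:\mathbb C[\lambda]\to\mathbb C$ is defined by $\langle\widehat\Psi_{j,i},\lambda^n\rangle=\bigl((\mathscr H_{(a)})^n\bigr)_{b_j,c_i}$. Let $s_{j,i}\in\{0,\dots,M-1\}$ with $s_{j,i}\equiv a(c_i)-a(b_j)\pmod M$; then $\langle\widehat\Psi_{j,i},\lambda^n\rangle=0$ unless $n\equiv s_{j,i}\pmod M$. The radial functional $\mathcal R_{j,i}:\mathbb C[x]\to\mathbb C$ is $\mathcal R_{j,i}(x^k)=\bigl((\mathscr H_{(a)})^{s_{j,i}+Mk}\bigr)_{b_j,c_i}$. A measure represents a functional if it has the same moments. $x^{1/M}$ is the nonnegative root and $|\rho|$ is the total variation measure. *)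

(* Defs.v *)
From HB Require Import structures.
From Stdlib Require Export Relation_Operators.
From mathcomp Require Export all_boot all_order all_algebra.
From mathcomp Require Export all_classical all_reals all_analysis.
From mathcomp Require Export complex.

Set Implicit Arguments.
Unset Strict Implicit.
Unset Printing Implicit Defensive.

Export Order.TTheory GRing.Theory Num.Theory.
Export numFieldNormedType.Exports.

Local Open Scope classical_set_scope.
Local Open Scope ring_scope.
Local Open Scope complex_scope.

(* The Borel sigma-algebra of the complex plane, transported from R * R. *)
Section complex_measurable.
Variable R : realType.

Definition complex_of_pair (z : R * R) : R[i] := z.1 +i* z.2.

Definition measurableC_sets : set (set R[i]) :=
  [set A | measurable (complex_of_pair @^-1` A)].

Let mC0 : measurableC_sets set0.
Proof. by rewrite /measurableC_sets /= preimage_set0; exact: measurable0. Qed.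

Let mCC A : measurableC_sets A -> measurableC_sets (~` A).
Proof.
by rewrite /measurableC_sets /= preimage_setC => mA; exact: measurableC.
Qed.

Let mC_bigcup (F : (set R[i])^nat) :
  (forall k, measurableC_sets (F k)) -> measurableC_sets (\bigcup_k F k).
Proof.
rewrite /measurableC_sets /= preimage_bigcup => mF.
exact: bigcupT_measurable.
Qed.

HB.instance Definition _ := isPointed.Build R[i] 0.
HB.instance Definition _ :=
  isMeasurable.Build default_measure_display R[i] mC0 mCC mC_bigcup.

End complex_measurable.

(* Charges are finite by definition in the library, so a finite complex measure
   is a pair of charges. *)
Record cmeasure d (T : measurableType d) (R : realType) := CMeasure {
  cm_re : {charge set T -> \bar R} ;
  cm_im : {charge set T -> \bar R} }.

Section complex_measures.
Context d (T : measurableType d) (R : realType).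
Implicit Types (nu : cmeasure T R) (A D : set T).

Definition cm_val nu A : R[i] := fine (cm_re nu A) +i* fine (cm_im nu A).

(* |nu|(A), the supremum over countable measurable partitions of A *)
Definition total_variation nu A : \bar R :=
  ereal_sup [set (\sum_(0 <= k <oo) (complex.Re `|cm_val nu (F k)|)%:E)%E
    | F in [set F : (set T)^nat |
        [/\ forall k, measurable (F k), trivIset setT F & \bigcup_k F k = A]]].

(* The value does not depend on the Hahn decomposition
   (Hahn_decomposition_uniq). *)
Lemma hahn_split (nu : {charge set T -> \bar R}) :
  {PN : set T * set T | hahn_decomposition nu PN.1 PN.2}.
Proof.
by apply: cid; have [P [N PN]] := Hahn_decomposition nu; exists (P, N).
Qed.

Definition charge_integral (nu : {charge set T -> \bar R}) D (f : T -> R) : R :=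
  let PN := svalP (hahn_split nu) in
  \int[jordan_pos PN]_(x in D) f x - \int[jordan_neg PN]_(x in D) f x.

Definition cintegral nu D (f : T -> R[i]) : R[i] :=
  let re x := complex.Re (f x) in
  let im x := complex.Im (f x) in
  (charge_integral (cm_re nu) D re - charge_integral (cm_im nu) D im) +i*
  (charge_integral (cm_re nu) D im + charge_integral (cm_im nu) D re).

Definition concentrated_on nu D : Prop :=
  forall A, measurable A -> A `&` D = set0 -> cm_val nu A = 0.

(* [var] is the embedding of T in the complex plane. *)
Definition represents (var : T -> R[i]) nu D (Lambda : {poly R[i]} -> R[i]) :=
  concentrated_on nu D /\
  forall n, cintegral nu D (fun z => var z ^+ n) = Lambda 'X^n.

End complex_measures.

Definition moment_functional (C : nzRingType) (m : nat -> C) (f : {poly C}) : C :=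
  \sum_(n < size f) f`_n * m n.

Section infinite_matrices.
Variables (R : realType) (S : choiceType).

Definition imx := S -> S -> R.

(* All the matrices below have finite rows, so the sum has finite support. *)
Definition imx_mul (A B : imx) : imx :=
  fun x z => \sum_(y \in [set: S]) A x y * B y z.

Definition imx_one : imx := fun x y => (x == y)%:R.

Definition imx_pow (A : imx) n : imx := iter n (imx_mul A) imx_one.

End infinite_matrices.

Definition norm_pos_lower (R : realType) (A : imx R nat) : Prop :=
  [/\ forall n, A n n = 1,
      forall n, 0 < A n.+1 n
    & forall m n, m <> n -> m <> n.+1 -> A m n = 0].

Definition norm_pos_upper (R : realType) (A : imx R nat) : Prop :=
  [/\ forall n, A n n.+1 = 1,
      forall n, 0 < A n n
    & forall m n, n <> m -> n <> m.+1 -> A m n = 0].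

(* A factor with its type; [true] is the letter L, [false] the letter U. *)
Definition factor (R : realType) : Type := bool * imx R nat.

Inductive exchange (R : realType) : seq (factor R) -> seq (factor R) -> Prop :=
  Exchange s1 s2 U L L' U' of
    norm_pos_upper U & norm_pos_lower L &
    norm_pos_lower L' & norm_pos_upper U' &
    imx_mul U L = imx_mul L' U' :
  exchange (s1 ++ [:: (false, U); (true, L)] ++ s2)
           (s1 ++ [:: (true, L'); (false, U')] ++ s2).

Section combinatorics.
Local Open Scope nat_scope.
Variables p q : nat.

Definition Pnum := p %/ gcdn p q.
Definition Qnum := q %/ gcdn p q.
Definition Rnum := Pnum + Qnum.

Definition ceil_div m n := (m + n.-1) %/ n.

Definition a_minus := p - ceil_div Pnum Qnum + 1.
Definition a_plus := p + 1 + minn (q - 1) (ceil_div Qnum Pnum).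

Definition rk k := (k * Qnum) %% Rnum.

Definition sigma_min : seq bool := [seq rk k < Pnum | k <- iota 0 (p + q)].

(* States are pairs (h, j); positions j run from 1 to p + q. *)
Definition omega j := rk j.-1.

Definition is_state (x : nat * nat) : bool :=
  [&& 0 < x.2 <= p + q, omega x.2 <= x.1 & Rnum %| x.1 - omega x.2].

Definition state_index (x : nat * nat) := (x.1 - omega x.2) %/ Rnum.

Definition next_pos j := if j < p + q then j.+1 else 1.

(* The states with h < N, in increasing order (by h, then by j). *)
Definition states_below N : seq (nat * nat) :=
  [seq x <- [seq (h, j) | h <- iota 0 N, j <- iota 1 (p + q)] | is_state x].

(* The k-th state, from 0. There are (p + q) * (k + 1) > k states with
   h < Rnum * (k + 1), so the default value is not used. *)
Definition nth_state k := nth (0, 1) (states_below (Rnum * k.+1)) k.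

(* s_{j,i}, with b_j = nth_state j and c_i = nth_state i *)
Definition shift j i :=
  ((nth_state i).2 + (p + q - (nth_state j).2)) %% (p + q).

End combinatorics.

Section recurrence_matrix.
Variables (R : realType) (p q : nat).

(* F_1, ..., F_{p+q} = L_1, ..., L_p, U_q, ..., U_1 *)
Definition Ffactor (L U : nat -> imx R nat) (k : nat) : factor R :=
  if (k <= p)%N then (true, L k) else (false, U (q + 1 - (k - p))%N).

Definition cyclic_factors (L U : nat -> imx R nat) (a : nat) : seq (factor R) :=
  [seq Ffactor L U k | k <- iota a ((p + q).+1 - a) ++ iota 1 a.-1].

(* H_(a), for the list tF of factors; extended by 0 outside the states. *)
Definition Hmx (tF : seq (factor R)) : imx R (nat * nat)%type := fun x y =>
  if [&& is_state p q x, is_state p q y & y.2 == next_pos p q x.2] then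
    let F := nth (true, fun _ _ => 0) tF x.2.-1 in
    let n := state_index p q x in
    if y.1 == (x.1 + Qnum p q)%N then 1
    else if (y.1 + Pnum p q)%N == x.1 then
      if F.1 then (if (0 < n)%N then F.2 n n.-1 else 0) else F.2 n n
    else 0
  else 0.

Definition Hpow (tF : seq (factor R)) (j i n : nat) : R[i] :=
  (imx_pow (Hmx tF) n (nth_state p q j) (nth_state p q i))%:C.

Definition Psi_functional (tF : seq (factor R)) (j i : nat) :
    {poly R[i]} -> R[i] :=
  moment_functional (Hpow tF j i).

Definition radial_functional (tF : seq (factor R)) (j i : nat) :
    {poly R[i]} -> R[i] :=
  moment_functional (fun k => Hpow tF j i (shift p q j i + (p + q) * k)).

End recurrence_matrix.

Section star.
Variables (R : realType) (M : nat).

Definition zeta : R[i] := cos (2 * pi / M%:R) +i* sin (2 * pi / M%:R).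

(* the nonnegative M-th root *)
Definition rootM (x : R) : R := x `^ (M%:R^-1).

Definition star (R0 : R) : set R[i] :=
  [set z | exists2 r : nat, (r < M)%N &
     exists2 t : R, 0 <= t <= rootM R0 & z = zeta ^+ r * t%:C].

(* x^{-s/M} *)
Definition weight (s : nat) (x : R) : R := x `^ (- (s%:R / M%:R)).

Definition radial_condition (s : nat) (R0 : R) (rho : cmeasure R R) : Prop :=
  (0 < s)%N ->
  cm_val rho [set 0] = 0 /\
  (\int[total_variation rho]_(x in `]0%R, R0]) (weight s x)%:E < +oo)%E.

(* the interval of integration of the lift: the origin counts only if s = 0 *)
Definition radial_dom (s : nat) (R0 : R) : set R :=
  if s == 0%N then `[0, R0]%classic else `]0, R0]%classic.

End star.

(* Main.v *)
From HB Require Import structures.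
Require Import Defs.
From mathcomp Require Import measurable_realfun.
From mathcomp Require Import ring lra zify.

Set Implicit Arguments.
Unset Strict Implicit.
Unset Printing Implicit Defensive.

Local Open Scope classical_set_scope.
Local Open Scope ring_scope.
Local Open Scope complex_scope.

(** The matrices matter only through a periodicity: each step of the recurrence
    matrix advances the factor-position label by one, so that the functional Psi
    kills lambda^n unless n = s modulo M ([Hpow_eq0]), while its values at
    lambda^(s + Mk) are those of the radial functional at x^k. The rest is measure
    theory on the star, which is the preimage of [0, R0] under z |-> z^M ([starP]).

    Necessity. Let nu represent Psi on the star. The image of z^s dnu under
    z |-> z^M lives on [0, R0], and its k-th moment is the moment of order s + Mk of
    nu, that is the k-th moment of rho. A complex measure on a bounded interval is
    determined by its moments ([cmeasure_moment_unique]), so that rho is this image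
    ([radial_density]). If s > 0, z^s vanishes at 0 and rho has no atom there;
    moreover |rho| is bounded by a constant times the image of |z|^s d|nu|, and the
    weight x^(-s/M) cancels |z|^s ([radial_condition_necessary]).

    Sufficiency. Under the radial condition x^(-s/M) drho is a finite complex
    measure. Transport it to each of the M rays and add the images with the
    coefficients zeta^(-rs) / M ([lift_exists]). By orthogonality of the characters
    of the cyclic group ([sum_zeta]), integrating a power of lambda gives 0 unless its
    exponent is congruent to s, and otherwise the corresponding moment of rho. The same
    orthogonality, applied to the factorization of lambda^M - z^M by lambda - z, gives
    the Cauchy transform ([resolvent_sum]). In all three cases [lift_value] reduces
    the claim to a pointwise identity.

    Integrals with respect to complex measures. They are defined by the Jordan
    decompositions of the real and imaginary parts, which do not behave well under
    sums, products and images. They are therefore computed from densities: every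
    complex measure is h dm, with m positive and finite ([cmeasure_density]), and if
    a complex measure is a finite sum of images of such measures, its integral is the
    sum of the corresponding integrals ([cintegral_density_sum]). The reason is that
    the integral with respect to a charge can be computed from every splitting of
    the charge into two finite measures ([charge_diffE]).

    Determinacy of moments. By dominated convergence, it is enough to have polynomials
    that converge boundedly on [0, R0] to the indicator function of [0, a[. Up to an
    affine substitution, (1 - y^(2n))^(n 4^n) will do ([cutoff]). *)

(** * Positive densities, and integrals as monotone functions of the measure *)

Section density.
Context d (T : measurableType d) (R : realType).
Variables (m : {finite_measure set T -> \bar R}) (g : T -> R).
Hypothesis intg : m.-integrable setT (EFin \o g).
Hypothesis g0 : forall x, 0 <= g x.

Lemma density_ge0 A : (0 <= induced_charge intg A)%E.
Proof. by apply: integral_ge0 => x _; rewrite lee_fin. Qed.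

Definition density := measure_of_charge _ density_ge0.

HB.instance Definition _ := Measure.on density.

Lemma density_finite : fin_num_fun density.
Proof. by move=> A mA; exact: fin_num_measure. Qed.

HB.instance Definition _ := @Measure_isFinite.Build _ _ _ density density_finite.

(** The Radon-Nikodym theorem provides some density of [density] with respect to
    [m]; it agrees with [g] almost everywhere because both have the same integral
    over every measurable set. *)
Lemma ge0_integral_density D (f : T -> \bar R) :
    measurable D -> measurable_fun D f -> (forall x, 0 <= f x)%E ->
  (\int[density]_(x in D) f x = \int[m]_(x in D) (f x * (g x)%:E))%E.
Proof.
move=> mD mf f0.
have dm : density `<< m.
  apply/null_content_dominatesP => A mA mA0.
  rewrite /density /measure_of_charge /=; apply: null_set_integral => //.
  exact: measurable_funTS (measurable_int _ intg).
rewrite -(Radon_Nikodym_SigmaFinite.change_of_variables dm)//.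
apply: ae_eq_integral => //.
- apply: emeasurable_funM => //; apply: measurable_funTS.
  exact: measurable_int (Radon_Nikodym_SigmaFinite.f_integrable dm).
- apply: emeasurable_funM => //; apply: measurable_funTS.
  exact: measurable_int intg.
apply: ae_eqe_mul2l; apply: integral_ae_eq => //.
- apply: integrableS (Radon_Nikodym_SigmaFinite.f_integrable dm) => //.
- exact: measurable_funTS (measurable_int _ intg).
by move=> A AE mA; rewrite -Radon_Nikodym_SigmaFinite.f_integral.
Qed.

End density.

Section density_integrable.
Context d (T : measurableType d) (R : realType).
Variables (m : {finite_measure set T -> \bar R}) (g : T -> R).
Hypothesis intg : m.-integrable setT (EFin \o g).
Hypothesis g0 : forall x, 0 <= g x.
Variables (D : set T) (f : T -> R).
Hypotheses (mD : measurable D) (mf : measurable_fun D f).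

Lemma integrable_density : m.-integrable D (fun x => (f x * g x)%:E) ->
  (density intg g0).-integrable D (EFin \o f).
Proof.
move=> intfg.
apply/integrableP; split; first exact/measurable_EFinP.
rewrite ge0_integral_density//.
  move/integrableP : intfg => [_]; apply: le_lt_trans.
  rewrite le_eqVlt; apply/orP; left; apply/eqP/eq_integral => x _.
  by rewrite /= normrM EFinM (ger0_norm (g0 x)).
by apply: measurableT_comp => //; exact/measurable_EFinP.
Qed.

Lemma Rintegral_density :
  \int[density intg g0]_(x in D) f x = \int[m]_(x in D) (f x * g x).
Proof.
congr fine; rewrite integralE.
have mEf : measurable_fun D (EFin \o f) by exact/measurable_EFinP.
rewrite !ge0_integral_density//; [|exact: measurable_funeneg|exact: measurable_funepos].
rewrite [RHS]integralE; congr (_ - _)%E; apply: eq_integral => x _.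
  by rewrite !funeposE EFinM muleC maxe_pMr ?lee_fin// mule0 muleC.
by rewrite !funenegE EFinM -mulNe muleC maxe_pMr ?lee_fin// mule0 muleC.
Qed.

End density_integrable.

Section set_function_integral.
Import HBNNSimple.

(** The integral is a supremum of sums weighted by the values of the set function
    on level sets of simple functions, hence monotone in the set function. It will be
    applied with a total variation on either side. *)
Lemma le_setfun_integral d (T : measurableType d) (R : realType)
    (m1 m2 : set T -> \bar R) D (f : T -> \bar R) :
    m1 set0 = 0%E -> m2 set0 = 0%E ->
    (forall A, measurable A -> 0 <= m1 A <= m2 A)%E ->
    (forall x, D x -> 0 <= f x)%E ->
  (\int[m1]_(x in D) f x <= \int[m2]_(x in D) f x)%E.
Proof.
move=> m10 m20 m12 f0.
have fD0 x : (0 <= (f \_ D) x)%E by rewrite patchE; case: ifPn => [/[!inE]/f0|_].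
have fn0 : ((f \_ D)^\- = cst 0)%E.
  by apply/funext => x; apply: (@ge0_funenegE _ _ setT); rewrite ?inE.
have sint0 (m : set T -> \bar R) (h : {nnsfun T >-> R}) : m set0 = 0%E ->
    (forall x, (h x)%:E <= (cst 0 : T -> \bar R) x)%E -> sintegral m h = 0%E.
  move=> m0 h0; have {}h0 x : h x = 0 by apply/eqP; rewrite eq_le -lee_fin h0/=.
  rewrite /sintegral fsbig1// => r _; have [->|r0] := eqVneq r 0; first by rewrite mul0e.
  rewrite (_ : _ @^-1` _ = set0) ?m0 ?mule0//; apply/seteqP; split => x //=.
  by rewrite h0 => /esym/eqP; rewrite (negbTE r0).
have nn0 (m : set T -> \bar R) : m set0 = 0%E ->
    ereal_sup [set sintegral m h | h in
      [set h : {nnsfun T >-> R} | forall x, (h x)%:E <= (cst 0 : T -> \bar R) x]%E] = 0%E.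
  move=> m0; apply/eqP; rewrite eq_le; apply/andP; split.
    by apply: ge_ereal_sup => _ [h /= h0 <-]; rewrite (sint0 _ _ m0 h0).
  apply: ereal_sup_ubound; exists (@nnsfun0 _ T R) => //.
  exact: sint0.
rewrite /integral fn0 !nn0// !sube0.
apply: ge_ereal_sup => _ [h/= hf] <-; apply: le_ereal_sup_tmp.
exists (sintegral m2 h); first by exists h.
have sE (m : set T -> \bar R) : m set0 = 0%E ->
    sintegral m h = (\sum_(x \in range h) x%:E * m (h @^-1` [set x]))%E.
  move=> m0; rewrite /sintegral (fsbig_widen (range h) setT)//= => x [_ Nhx] /=.
  by rewrite preimage10// m0 mule0.
rewrite !sE//; apply: lee_fsum => // _ [t _ <-].
have /m12/andP[m1h0 m1h] : measurable (h @^-1` [set h t]) by [].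
by rewrite lee_pmul ?lee_fin.
Qed.

End set_function_integral.

(** * Integration with respect to a charge split as a difference of measures *)

Section finite_copy.
Context d (T : measurableType d) (R : realType).
Variables (m : {measure set T -> \bar R}) (mT : (m setT < +oo)%E).

(** The proof of finiteness is a parameter so that the structure of a finite measure
    can be inferred from the term. *)
Definition finite_copy : set T -> \bar R := let _ := mT in m.

HB.instance Definition _ := isMeasure.Build _ _ _ finite_copy
  (measure0 m) (measure_ge0 m) (@measure_semi_sigma_additive _ _ _ m).

HB.instance Definition _ :=
  @Measure_isFinite.Build _ _ _ finite_copy (lty_fin_num_fun mT).

End finite_copy.

Section finite_measures.
Context d (T : measurableType d) (R : realType).
Implicit Types (m : {finite_measure set T -> \bar R}) (D : set T) (f : T -> R).

Lemma finite_measure_add m1 m2 : exists mu : {finite_measure set T -> \bar R},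
  mu = measure_add m1 m2 :> (set T -> \bar R).
Proof.
have mT : (measure_add m1 m2 setT < +oo)%E.
  by rewrite measure_addE lte_add_pinfty// ltey_eq fin_num_measure.
by exists (finite_copy mT).
Qed.

Lemma finite_measure_pushforward d' (T' : measurableType d') m (phi : T -> T') :
  measurable_fun setT phi ->
  exists mu : {finite_measure set T' -> \bar R},
    mu = pushforward m phi :> (set T' -> \bar R).
Proof.
move=> mphi.
have mT : (pushforward m phi setT < +oo)%E.
  by rewrite /pushforward preimage_setT ltey_eq fin_num_measure.
by unshelve eexists (finite_copy (m := pushforward m phi) mT).
Qed.

Lemma le_measure_integrable (m1 m2 : {measure set T -> \bar R}) D (f : T -> \bar R) :
  (forall A, measurable A -> m1 A <= m2 A)%E ->
  m2.-integrable D f -> m1.-integrable D f.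
Proof.
move=> m12 /integrableP[mf if2]; apply/integrableP; split => //.
apply: le_lt_trans if2; apply: le_setfun_integral => //.
by move=> A mA; rewrite measure_ge0 m12.
Qed.

Lemma eq_measure_Rintegral (m1 m2 : {measure set T -> \bar R}) D f :
    (forall A, measurable A -> m1 A = m2 A) ->
  \int[m1]_(x in D) f x = \int[m2]_(x in D) f x.
Proof. by move=> m12; congr fine; apply: eq_measure_integral => A *; exact: m12. Qed.

Lemma integrable_measure_add (m1 m2 : {measure set T -> \bar R}) D
    (f : T -> \bar R) : measurable D ->
  m1.-integrable D f -> m2.-integrable D f -> (measure_add m1 m2).-integrable D f.
Proof.
move=> mD /integrableP[mf i1] /integrableP[_ i2]; apply/integrableP; split => //.
rewrite ge0_integral_measure_add//; first exact: lte_add_pinfty.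
by apply: measurableT_comp.
Qed.

Lemma Rintegral_measure_add (m1 m2 : {measure set T -> \bar R}) D f :
  measurable D -> m1.-integrable D (EFin \o f) -> m2.-integrable D (EFin \o f) ->
  \int[measure_add m1 m2]_(x in D) f x =
  \int[m1]_(x in D) f x + \int[m2]_(x in D) f x.
Proof.
move=> mD i1 i2; rewrite /Rintegral integral_measure_add//.
by rewrite fineD//; exact: integrable_fin_num.
Qed.

End finite_measures.

Lemma fin_num_sub_exchange (R : realType) (a b c e : \bar R) :
  a \is a fin_num -> b \is a fin_num -> c \is a fin_num -> e \is a fin_num ->
  (a - b = c - e)%E -> (a + e = c + b)%E.
Proof.
move: a b c e => [a| |] [b| |] [c| |] [e| |]//= _ _ _ _ [abce].
by congr EFin; lra.
Qed.

Section charge_integral_theory.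
Context d (T : measurableType d) (R : realType).
Implicit Types (nu : {charge set T -> \bar R}) (D : set T) (f : T -> R).

(** The Jordan parts are the smallest measures whose difference is the charge. *)
Lemma jordan_pos_le nu (m1 m2 : {measure set T -> \bar R}) P N
    (PN : hahn_decomposition nu P N) :
    (forall A, measurable A -> nu A = m1 A - m2 A)%E ->
  forall A, measurable A -> (jordan_pos PN A <= m1 A)%E.
Proof.
move=> nuE A mA; have [[mP _] _ _ _] := PN.
have mAP : measurable (A `&` P) by exact: measurableI.
rewrite jordan_posE cjordan_posE /crestr0 mem_set//= /crestr nuE//.
by rewrite (@le_trans _ _ (m1 (A `&` P)))// ?le_measure ?inE// geeDl// oppe_le0.
Qed.

Lemma jordan_neg_le nu (m1 m2 : {measure set T -> \bar R}) P N
    (PN : hahn_decomposition nu P N) :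
    (forall A, measurable A -> nu A = m1 A - m2 A)%E ->
  forall A, measurable A -> (jordan_neg PN A <= m2 A)%E.
Proof.
move=> nuE A mA; have [_ [mN _] _ _] := PN.
have mAN : measurable (A `&` N) by exact: measurableI.
have nuAN : nu (A `&` N) \is a fin_num by rewrite fin_num_measure.
rewrite jordan_negE cjordan_negE /crestr0 mem_set//= /crestr.
rewrite (@le_trans _ _ (m2 (A `&` N)))// ?le_measure ?inE//.
have m1_ge0 : (0 <= m1 (A `&` N))%E by [].
have m2_ge0 : (0 <= m2 (A `&` N))%E by [].
move: nuAN m1_ge0 m2_ge0; rewrite nuE//.
by move: (m1 _) (m2 _) => [x| |] [y| |]//=; rewrite !lee_fin => _ x0 y0; lra.
Qed.

Lemma jordan_pos_neg nu P N (PN : hahn_decomposition nu P N) A : measurable A ->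
  nu A = (jordan_pos PN A - jordan_neg PN A)%E.
Proof. by move=> mA; rewrite (jordan_decomp PN mA)/= /cadd/= cscaleN1. Qed.

(** [v] is the integral of [f] computed from some splitting of [nu] into finite
    measures. Unlike Jordan decompositions, such splittings can be added and need not
    have disjoint supports. *)
Definition charge_diff (nu : set T -> \bar R) D f v :=
  exists m1 m2 : {finite_measure set T -> \bar R},
  [/\ forall A, measurable A -> nu A = (m1 A - m2 A)%E,
      m1.-integrable D (EFin \o f), m2.-integrable D (EFin \o f) &
      v = \int[m1]_(x in D) f x - \int[m2]_(x in D) f x].

(** If p - n is the Jordan decomposition and m1 - m2 another splitting, then p + m2
    and m1 + n are the same measure, and [f] is integrable with respect to p and n
    because they are bounded by m1 and m2. *)
Lemma charge_diffE nu D f v : measurable D -> charge_diff nu D f v ->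
  charge_integral nu D f = v.
Proof.
move=> mD [m1 [m2 [nuE i1 i2 ->]]]; rewrite /charge_integral.
move: (svalP (hahn_split nu)) => PN.
pose p : {finite_measure set T -> \bar R} := jordan_pos PN.
pose n : {finite_measure set T -> \bar R} := jordan_neg PN.
rewrite -[X in X - _]/(\int[p]_(x in D) f x) -[X in _ - X]/(\int[n]_(x in D) f x).
have pi : p.-integrable D (EFin \o f).
  exact: le_measure_integrable (jordan_pos_le PN nuE) i1.
have ni : n.-integrable D (EFin \o f).
  exact: le_measure_integrable (jordan_neg_le PN nuE) i2.
apply/eqP; rewrite subr_eq addrAC eq_sym subr_eq eq_sym; apply/eqP.
rewrite -!Rintegral_measure_add//; congr fine.
apply: eq_measure_integral => A mA _.
rewrite [LHS]measure_addE [RHS]measure_addE.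
apply: fin_num_sub_exchange; rewrite ?fin_num_measure//.
by rewrite -nuE// (jordan_pos_neg PN).
Qed.

Lemma charge_diff_ext (nu nu' : set T -> \bar R) D f v :
  (forall A, measurable A -> nu A = nu' A) ->
  charge_diff nu D f v -> charge_diff nu' D f v.
Proof.
by move=> nuE [m1 [m2 [h *]]]; exists m1, m2; split=> // A mA; rewrite -nuE ?h.
Qed.

Lemma charge_diffD (nu1 nu2 : set T -> \bar R) D f v1 v2 : measurable D ->
  charge_diff nu1 D f v1 -> charge_diff nu2 D f v2 ->
  charge_diff (fun A => nu1 A + nu2 A)%E D f (v1 + v2).
Proof.
move=> mD [a1 [b1 [nu1E ia1 ib1 ->]]] [a2 [b2 [nu2E ia2 ib2 ->]]].
have [a aE] := finite_measure_add a1 a2; have [b bE] := finite_measure_add b1 b2.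
exists a, b; rewrite aE bE; split.
- move=> A mA; rewrite nu1E// nu2E// !measure_addE.
  by rewrite oppeD ?fin_num_adde_defr ?fin_num_measure// addeACA.
- exact: integrable_measure_add.
- exact: integrable_measure_add.
- have -> : \int[a]_(x in D) f x = \int[measure_add a1 a2]_(x in D) f x.
    by apply: eq_measure_Rintegral => A _; exact: (congr1 (@^~ A) aE).
  have -> : \int[b]_(x in D) f x = \int[measure_add b1 b2]_(x in D) f x.
    by apply: eq_measure_Rintegral => A _; exact: (congr1 (@^~ A) bE).
  by rewrite !Rintegral_measure_add//; lra.
Qed.

End charge_integral_theory.

(** * Charges given by densities and image measures *)

Section charge_diff_density.
Context d d' (T : measurableType d) (T' : measurableType d') (R : realType).
Variables (m : {finite_measure set T' -> \bar R}).
Implicit Types (D : set T) (f : T -> R) (g : T' -> R) (phi : T' -> T).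

Lemma measurable_preimage phi D : measurable_fun setT phi -> measurable D ->
  measurable (phi @^-1` D).
Proof. by move=> mphi mD; rewrite -[X in measurable X]setTI; exact: mphi. Qed.

(** [mu] is the image under [phi] of the measure of density [g]. *)
Lemma density_pushforward phi g D f (g0 : forall x, 0 <= g x)
    (intg : m.-integrable setT (EFin \o g)) :
  measurable_fun setT phi -> measurable D -> measurable_fun setT f ->
  m.-integrable (phi @^-1` D) (fun x => (f (phi x) * g x)%:E) ->
  exists mu : {finite_measure set T -> \bar R},
  [/\ forall A, measurable A -> mu A = (\int[m]_(x in phi @^-1` A) g x)%:E,
      mu.-integrable D (EFin \o f) &
      \int[mu]_(x in D) f x = \int[m]_(x in phi @^-1` D) (f (phi x) * g x)].
Proof.
move=> mphi mD mf ifg.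
have mpD := measurable_preimage mphi mD.
have mfp : measurable_fun (phi @^-1` D) (f \o phi).
  by apply: measurable_funTS; exact: measurableT_comp.
have [mu muE] := finite_measure_pushforward (density intg g0) mphi.
have mEf : measurable_fun [set: T] (EFin \o f) by exact/measurable_EFinP.
exists mu; split.
- move=> A mA; rewrite muE /pushforward /= /density /measure_of_charge /=.
  rewrite /induced_charge /Rintegral fineK//; apply: integrable_fin_num => //.
    exact: measurable_preimage.
  by apply: (integrableS _ _ _ intg) => //; exact: measurable_preimage.
- rewrite muE; apply: (@integrable_pushforward _ _ _ _ _ _ mphi) => //.
  exact: (integrable_density intg g0 mpD mfp ifg).
- rewrite -(Rintegral_density intg g0 mpD mfp) /Rintegral; congr fine.
  rewrite -[RHS](@integral_pushforward _ _ _ _ _ _ mphi _ D (EFin \o f))//.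
    exact: (congr1 (fun n => integral n D (EFin \o f)) muE).
  exact: (integrable_density intg g0 mpD mfp ifg).
Qed.

Lemma charge_diff_density phi g D f : measurable_fun setT phi ->
  m.-integrable setT (EFin \o g) -> measurable D -> measurable_fun setT f ->
  m.-integrable (phi @^-1` D) (fun x => (f (phi x) * g x)%:E) ->
  charge_diff (fun A => (\int[m]_(x in phi @^-1` A) g x)%:E) D f
    (\int[m]_(x in phi @^-1` D) (f (phi x) * g x)).
Proof.
move=> mphi ig mD mf ifg.
have igp := integrable_funrpos measurableT ig.
have ign := integrable_funrneg measurableT ig.
have mpD := measurable_preimage mphi mD.
have gE x : g x = g^\+ x - g^\- x by rewrite -[LHS](congr1 (@^~ x) (funrposBneg g)).
have mg : measurable_fun setT g by exact/measurable_EFinP/measurable_int/ig.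
have mfp : measurable_fun (phi @^-1` D) (f \o phi).
  by apply: measurable_funTS; exact: measurableT_comp.
have bound (h : T' -> R) : measurable_fun setT h ->
    (forall x, `|h x| <= `|g x|) ->
    m.-integrable (phi @^-1` D) (fun x => (f (phi x) * h x)%:E).
  move=> mh hg; apply: le_integrable ifg => //.
    apply/measurable_EFinP; apply: measurable_funM => //.
    exact: measurable_funTS.
  by move=> x _; rewrite /= lee_fin !normrM ler_wpM2l.
have ip : m.-integrable (phi @^-1` D) (fun x => (f (phi x) * g^\+ x)%:E).
  apply: bound; first exact: measurable_funrpos.
  move=> x; rewrite ger0_norm ?funrpos_ge0//.
  by rewrite /funrpos ge_max ler_norm/=.
have inn : m.-integrable (phi @^-1` D) (fun x => (f (phi x) * g^\- x)%:E).
  apply: bound; first exact: measurable_funrneg.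
  move=> x; rewrite ger0_norm ?funrneg_ge0//.
  by rewrite /funrneg ge_max -normrN ler_norm/=.
have [mu1 [mu1E i1 v1]] :=
  density_pushforward (@funrpos_ge0 _ _ g) igp mphi mD mf ip.
have [mu2 [mu2E i2 v2]] :=
  density_pushforward (@funrneg_ge0 _ _ g) ign mphi mD mf inn.
exists mu1, mu2; split => //.
- move=> A mA; rewrite mu1E// mu2E// -EFinB.
  have mpA := measurable_preimage mphi mA.
  rewrite -RintegralB//; [|exact: integrableS igp|exact: integrableS ign].
  by congr EFin; apply: eq_Rintegral => x _.
- rewrite v1 v2 -RintegralB//.
  by apply: eq_Rintegral => x _; rewrite gE mulrBr.
Qed.

End charge_diff_density.

Section charge_sum.
Context d d' (T : measurableType d) (T' : measurableType d') (R : realType).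
Variables (m : {finite_measure set T' -> \bar R}) (I : Type).
Implicit Types (D : set T) (f : T -> R) (g : I -> T' -> R) (phi : I -> T' -> T).

Lemma charge_diff0 D f : measurable D -> measurable_fun setT f ->
  charge_diff (fun A : set T => 0%:E) D f (0 : R).
Proof.
move=> mD mf.
have z0 : (@mzero _ T R setT < +oo)%E by rewrite /mzero ltry.
exists (finite_copy z0), (finite_copy z0).
have iz : (finite_copy z0).-integrable D (EFin \o f).
  apply/integrableP; split; first exact/measurable_funTS/measurable_EFinP.
  by rewrite (integral_measure_zero D).
by split; rewrite ?subrr// => A mA; rewrite subee.
Qed.

(** Change of variables for a charge presented as a finite sum of images of
    measures with signed densities: the positive and negative parts of the densities
    give a splitting of each term, and splittings add up. *)
Lemma charge_integral_density_sum s phi g (nu : {charge set T -> \bar R}) D f :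
  (forall r, measurable_fun setT (phi r)) ->
  (forall r, m.-integrable setT (EFin \o g r)) ->
  (forall A, measurable A ->
    nu A = (\sum_(r <- s) \int[m]_(x in phi r @^-1` A) g r x)%:E) ->
  measurable D -> measurable_fun setT f ->
  (forall r, m.-integrable (phi r @^-1` D) (fun x => (f (phi r x) * g r x)%:E)) ->
  charge_integral nu D f =
  \sum_(r <- s) \int[m]_(x in phi r @^-1` D) (f (phi r x) * g r x).
Proof.
move=> mphi ig nuE mD mf ifg; apply: charge_diffE => //.
apply: (@charge_diff_ext _ _ _
  (fun A => (\sum_(r <- s) \int[m]_(x in phi r @^-1` A) g r x)%:E)).
  by move=> A mA; rewrite nuE.
elim: s {nuE} => [|r s IHs].
  apply: (@charge_diff_ext _ _ _ (fun A : set T => 0%:E)); rewrite ?big_nil//.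
    by move=> A mA; rewrite big_nil.
  exact: charge_diff0.
rewrite big_cons; have := charge_diffD mD
  (charge_diff_density (mphi r) (ig r) mD mf (ifg r)) IHs.
by apply: charge_diff_ext => A mA; rewrite big_cons.
Qed.

Lemma charge_density_sum s phi g :
  (forall r, measurable_fun setT (phi r)) ->
  (forall r, m.-integrable setT (EFin \o g r)) ->
  exists nu : {charge set T -> \bar R}, forall A, measurable A ->
    nu A = (\sum_(r <- s) \int[m]_(x in phi r @^-1` A) g r x)%:E.
Proof.
move=> mphi ig; elim: s => [|r s [nu nuE]].
  by exists (@czero _ T R) => A mA; rewrite big_nil.
unshelve eexists (cadd (pushforward (induced_charge (ig r)) (phi r)) nu) => //.
move=> A mA; rewrite big_cons EFinD -nuE//; congr (_ + _)%E.
rewrite /pushforward /induced_charge /Rintegral fineK//.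
apply: integrable_fin_num; first exact: measurable_preimage.
by apply: (integrableS _ _ _ (ig r)) => //; exact: measurable_preimage.
Qed.

End charge_sum.

(** * Borel measurability of complex-valued functions *)

Section complex_measurability.
Context (R : realType) d (T : measurableType d).
Implicit Types (D : set T) (f g : T -> R[i]).

Lemma measurable_Re : measurable_fun setT (@complex.Re R : R[i] -> R).
Proof.
move=> _ A mA; rewrite setTI /measurable/= /measurableC_sets/=.
have -> : @complex_of_pair R @^-1` (@complex.Re R @^-1` A) = A `*` setT.
  by apply/seteqP; split => -[x y] //= [].
exact: measurableX.
Qed.

Lemma measurable_Im : measurable_fun setT (@complex.Im R : R[i] -> R).
Proof.
move=> _ A mA; rewrite setTI /measurable/= /measurableC_sets/=.
have -> : @complex_of_pair R @^-1` (@complex.Im R @^-1` A) = setT `*` A.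
  by apply/seteqP; split => -[x y] //= [].
exact: measurableX.
Qed.

Lemma measurable_complexP f : measurable_fun setT f <->
  measurable_fun setT (@complex.Re R \o f) /\
  measurable_fun setT (@complex.Im R \o f).
Proof.
split=> [mf|[mre mim]].
  by split; apply: measurableT_comp mf; [exact: measurable_Re|exact: measurable_Im].
move=> _ A mA; rewrite (_ : f @^-1` A =
  (fun x => (complex.Re (f x), complex.Im (f x))) @^-1` (@complex_of_pair R @^-1` A)).
  have mp := measurable_fun_pair mre mim; exact: mp.
by apply/seteqP; split => x /=; rewrite /complex_of_pair /=; case: (f x).
Qed.

Lemma measurable_real_complex : measurable_fun setT (fun x : R => x%:C).
Proof.
move=> _ A mA; rewrite setTI.
rewrite (_ : _ @^-1` A = (fun x => (x, 0)) @^-1` (@complex_of_pair R @^-1` A))//.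
have mp : measurable_fun setT (fun x : R => (x, 0 : R)).
  exact: measurable_fun_pair.
by rewrite -[X in measurable X]setTI; exact: mp.
Qed.

Lemma measurable_cplxD f g : measurable_fun setT f -> measurable_fun setT g ->
  measurable_fun setT (fun x => f x + g x).
Proof.
move=> /measurable_complexP[f1 f2] /measurable_complexP[g1 g2].
apply/measurable_complexP; split.
  rewrite (_ : _ \o _ = (@complex.Re R \o f) \+ (@complex.Re R \o g)).
    exact: measurable_funD.
  by apply/funext => x /=; case: (f x) (g x) => ? ? [].
rewrite (_ : _ \o _ = (@complex.Im R \o f) \+ (@complex.Im R \o g)).
  exact: measurable_funD.
by apply/funext => x /=; case: (f x) (g x) => ? ? [].
Qed.

Lemma measurable_cplxM f g : measurable_fun setT f -> measurable_fun setT g ->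
  measurable_fun setT (fun x => f x * g x).
Proof.
move=> /measurable_complexP[f1 f2] /measurable_complexP[g1 g2].
apply/measurable_complexP; split.
  rewrite (_ : _ \o _ = ((@complex.Re R \o f) \* (@complex.Re R \o g)) \-
                        ((@complex.Im R \o f) \* (@complex.Im R \o g))).
    by apply: measurable_funB; exact: measurable_funM.
  by apply/funext => x /=; case: (f x) (g x) => ? ? [].
rewrite (_ : _ \o _ = ((@complex.Re R \o f) \* (@complex.Im R \o g)) \+
                      ((@complex.Im R \o f) \* (@complex.Re R \o g))).
  by apply: measurable_funD; exact: measurable_funM.
by apply/funext => x /=; case: (f x) (g x) => ? ? [].
Qed.

Lemma measurable_cplxB f g : measurable_fun setT f -> measurable_fun setT g ->
  measurable_fun setT (fun x => f x - g x).
Proof.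
move=> mf mg; apply: measurable_cplxD => //.
rewrite (_ : (fun x => - g x) = (fun x => (-1 : R[i]) * g x)).
  by apply: measurable_cplxM => //; exact: measurable_cst.
by apply/funext => x; rewrite mulN1r.
Qed.

Lemma measurable_cplxX f n : measurable_fun setT f ->
  measurable_fun setT (fun x => f x ^+ n).
Proof.
move=> mf; elim: n => [|n IHn].
  by under eq_fun do rewrite expr0; exact: measurable_cst.
by under eq_fun do rewrite exprS; exact: measurable_cplxM.
Qed.

Lemma measurable_normc f : measurable_fun setT f ->
  measurable_fun setT (fun x => Normc.normc (f x)).
Proof.
move=> /measurable_complexP[f1 f2].
rewrite (_ : (fun x => _) = (@Num.sqrt R) \o
  (fun x => (complex.Re (f x)) ^+ 2 + (complex.Im (f x)) ^+ 2)).
  apply: measurableT_comp; first exact: (continuous_measurable_fun (@sqrt_continuous R)).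
  by apply: measurable_funD; [exact: (measurable_funX 2 f1)|exact: (measurable_funX 2 f2)].
by apply/funext => x /=; case: (f x).
Qed.

Lemma measurable_cplxV f : measurable_fun setT f ->
  measurable_fun setT (fun x => (f x)^-1).
Proof.
move=> /measurable_complexP[f1 f2].
(* The inverse of the squared modulus, written as a power. *)
have mn : measurable_fun setT
    (fun x => (complex.Re (f x) ^+ 2 + complex.Im (f x) ^+ 2) `^ (-1)).
  have m2 := measurable_funD (measurable_funX 2 f1) (measurable_funX 2 f2).
  exact: (measurableT_comp (measurable_powR (-1)) m2).
have nE x : (complex.Re (f x) ^+ 2 + complex.Im (f x) ^+ 2) `^ (-1) =
    (complex.Re (f x) ^+ 2 + complex.Im (f x) ^+ 2)^-1.
  by rewrite powRN powRr1// addr_ge0// sqr_ge0.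
apply/measurable_complexP; split.
  rewrite (_ : _ \o _ = (@complex.Re R \o f) \* (fun x =>
     (complex.Re (f x) ^+ 2 + complex.Im (f x) ^+ 2) `^ (-1))).
    exact: measurable_funM.
  by apply/funext => x /=; rewrite nE; case: (f x).
rewrite (_ : _ \o _ = (fun x => - complex.Im (f x)) \* (fun x =>
     (complex.Re (f x) ^+ 2 + complex.Im (f x) ^+ 2) `^ (-1))).
  by apply: measurable_funM => //; exact: measurable_funN.
by apply/funext => x /=; rewrite nE; case: (f x) => ? ? /=; rewrite mulNr.
Qed.

End complex_measurability.

(** * Complex-valued integration with respect to a positive measure *)

Section complex_integral.
Context d (T : measurableType d) (R : realType).
Variable m : {measure set T -> \bar R}.
Implicit Types (D : set T) (f g : T -> R[i]).

Definition cintegrable D f :=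
  m.-integrable D (fun x => (complex.Re (f x))%:E) /\
  m.-integrable D (fun x => (complex.Im (f x))%:E).

Definition cint D f : R[i] :=
  (\int[m]_(x in D) complex.Re (f x)) +i* (\int[m]_(x in D) complex.Im (f x)).

Lemma normRe_le_normc (z : R[i]) : `|complex.Re z| <= Normc.normc z.
Proof.
case: z => a b /=; rewrite -sqrtr_sqr ler_sqrt ?lerDl ?sqr_ge0//.
by rewrite addr_ge0 ?sqr_ge0.
Qed.

Lemma normIm_le_normc (z : R[i]) : `|complex.Im z| <= Normc.normc z.
Proof.
case: z => a b /=; rewrite -sqrtr_sqr ler_sqrt ?lerDr ?sqr_ge0//.
by rewrite addr_ge0 ?sqr_ge0.
Qed.

Lemma normc_le_ReIm (z : R[i]) :
  Normc.normc z <= `|complex.Re z| + `|complex.Im z|.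
Proof.
case: z => a b /=; rewrite -[leRHS]ger0_norm ?addr_ge0// -sqrtr_sqr ler_sqrt.
  by rewrite sqrrD !real_normK ?num_real// addrAC lerDl mulrn_wge0// mulr_ge0.
by rewrite sqr_ge0.
Qed.

Lemma normc_ge0 (z : R[i]) : 0 <= Normc.normc z.
Proof. by case: z => a b /=; exact: sqrtr_ge0. Qed.

Lemma integrable_normc D f : measurable D -> measurable_fun setT f ->
  cintegrable D f -> m.-integrable D (fun x => (Normc.normc (f x))%:E).
Proof.
move=> mD mf [ir ii]; have := integrableD mD (integrable_abse ir) (integrable_abse ii).
apply: le_integrable => //.
  by apply/measurable_EFinP; apply: measurable_funTS; exact: measurable_normc.
move=> x _ /=; rewrite lee_fin [leRHS]ger0_norm ?addr_ge0//.
by rewrite ger0_norm ?normc_ge0// normc_le_ReIm.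
Qed.

Lemma le_cintegrable D f (h : T -> R) : measurable D -> measurable_fun setT f ->
  (forall x, D x -> Normc.normc (f x) <= h x) ->
  m.-integrable D (EFin \o h) -> cintegrable D f.
Proof.
move=> mD /measurable_complexP[mr mi] fh ih; split.
  apply: le_integrable ih => //.
    by apply/measurable_EFinP; apply: measurable_funTS; exact: mr.
  move=> x Dx /=; rewrite lee_fin (le_trans (normRe_le_normc _))//.
  by rewrite (le_trans (fh _ Dx))// ler_norm.
apply: le_integrable ih => //.
  by apply/measurable_EFinP; apply: measurable_funTS; exact: mi.
move=> x Dx /=; rewrite lee_fin (le_trans (normIm_le_normc _))//.
by rewrite (le_trans (fh _ Dx))// ler_norm.
Qed.

Lemma cintegrable_measurable f : cintegrable setT f -> measurable_fun setT f.
Proof.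
move=> [/measurable_int/measurable_EFinP mr /measurable_int/measurable_EFinP mi].
exact/measurable_complexP.
Qed.

Lemma cintegrableS D E f : measurable D -> measurable E -> E `<=` D ->
  cintegrable D f -> cintegrable E f.
Proof. by move=> mD mE ED [ir ii]; split; [exact: integrableS ir|exact: integrableS ii]. Qed.

Lemma eq_cintegrable D f g : measurable D -> {in D, f =1 g} ->
  cintegrable D f -> cintegrable D g.
Proof.
move=> mD fg [ir ii]; split.
  by apply: eq_integrable ir => // x Dx; rewrite fg.
by apply: eq_integrable ii => // x Dx; rewrite fg.
Qed.

Lemma eq_cint D f g : {in D, f =1 g} -> cint D f = cint D g.
Proof.
by move=> fg; congr Complex; apply: eq_Rintegral => x Dx; rewrite fg.
Qed.

Lemma cintegrableD D f g : measurable D -> cintegrable D f -> cintegrable D g ->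
  cintegrable D (fun x => f x + g x).
Proof.
move=> mD [fr fi] [gr gi]; split.
  apply: eq_integrable (integrableD mD fr gr) => // x _.
  by case: (f x) (g x) => ? ? [].
apply: eq_integrable (integrableD mD fi gi) => // x _.
by case: (f x) (g x) => ? ? [].
Qed.

Lemma cintD D f g : measurable D -> cintegrable D f -> cintegrable D g ->
  cint D (fun x => f x + g x) = cint D f + cint D g.
Proof.
move=> mD [fr fi] [gr gi]; rewrite /cint/=; congr Complex.
  rewrite -RintegralD//; apply: eq_Rintegral => x _.
  by case: (f x) (g x) => ? ? [].
rewrite -RintegralD//; apply: eq_Rintegral => x _.
by case: (f x) (g x) => ? ? [].
Qed.

Lemma cintegrableZ D (c : R[i]) f : measurable D -> cintegrable D f ->
  cintegrable D (fun x => c * f x).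
Proof.
case: c => a b mD [fr fi]; split.
  apply: eq_integrable
    (integrableB mD (integrableZl mD a fr) (integrableZl mD b fi)) => // x _.
  by case: (f x).
apply: eq_integrable
  (integrableD mD (integrableZl mD a fi) (integrableZl mD b fr)) => // x _.
by case: (f x).
Qed.

Lemma cintZ D (c : R[i]) f : measurable D -> cintegrable D f ->
  cint D (fun x => c * f x) = c * cint D f.
Proof.
case: c => a b mD [fr fi]; rewrite /cint; simpc.
have ifr r := integrableZl mD r fr; have ifi r := integrableZl mD r fi.
congr Complex.
  rewrite -!RintegralZl// -RintegralB//; last 2 first.
  - exact: ifr.
  - exact: ifi.
  by apply: eq_Rintegral => x _; case: (f x).
rewrite -!RintegralZl// -RintegralD//; last 2 first.
- exact: ifi.
- exact: ifr.
by apply: eq_Rintegral => x _; case: (f x).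
Qed.

Lemma cintegrable0 D : measurable D -> cintegrable D (fun=> 0).
Proof. by move=> mD; split; exact: integrable0. Qed.

Lemma cint0 D : cint D (fun=> 0) = 0.
Proof. by rewrite /cint /Rintegral/= !integral0_eq. Qed.

Lemma cint_sum I (s : seq I) D (F : I -> T -> R[i]) : measurable D ->
  (forall r, cintegrable D (F r)) ->
  cintegrable D (fun x => \sum_(r <- s) F r x) /\
  cint D (fun x => \sum_(r <- s) F r x) = \sum_(r <- s) cint D (F r).
Proof.
move=> mD iF; elim: s => [|r s [IHi IHc]].
  rewrite big_nil (@eq_cint _ _ (fun=> 0)); last by move=> x _; rewrite big_nil.
  rewrite cint0; split => //; apply: eq_cintegrable (cintegrable0 mD) => // x _.
  by rewrite big_nil.
rewrite big_cons -IHc -cintD//; split.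
  apply: eq_cintegrable (cintegrableD mD (iF r) IHi) => // x _.
  by rewrite big_cons.
by apply: eq_cint => x _; rewrite big_cons.
Qed.

End complex_integral.

(** * Complex measures given by densities and image measures *)

Lemma ReD (R : realType) (z w : R[i]) : complex.Re (z + w) = complex.Re z + complex.Re w.
Proof. by case: z w => ? ? []. Qed.

Lemma ImD (R : realType) (z w : R[i]) : complex.Im (z + w) = complex.Im z + complex.Im w.
Proof. by case: z w => ? ? []. Qed.

Lemma Re_sum (R : realType) I (s : seq I) (F : I -> R[i]) :
  complex.Re (\sum_(i <- s) F i) = \sum_(i <- s) complex.Re (F i).
Proof. by elim: s => [|i s IHs]; rewrite ?big_nil// !big_cons ReD IHs. Qed.

Lemma Im_sum (R : realType) I (s : seq I) (F : I -> R[i]) :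
  complex.Im (\sum_(i <- s) F i) = \sum_(i <- s) complex.Im (F i).
Proof. by elim: s => [|i s IHs]; rewrite ?big_nil// !big_cons ImD IHs. Qed.

Lemma complex_eqP (R : realType) (z w : R[i]) :
  complex.Re z = complex.Re w -> complex.Im z = complex.Im w -> z = w.
Proof. by case: z w => ? ? [? ?] /= -> ->. Qed.

Section cmeasure_density.
Local Open Scope charge_scope.
Context d (T : measurableType d) (R : realType).

Lemma charge_density_ex (nu : {charge set T -> \bar R})
    (m : {finite_measure set T -> \bar R}) :
  (forall A, measurable A -> `|nu A| <= m A)%E ->
  exists2 h : T -> R, m.-integrable setT (EFin \o h) &
    forall A, measurable A -> nu A = (\int[m]_(x in A) h x)%:E.
Proof.
move=> num.
have dom : nu `<< m.
  apply/null_content_dominatesP => A mA mA0; apply/eqP.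
  by rewrite -abse_eq0 eq_le abse_ge0 andbT -mA0 num.
have hE x : (fine ('d nu '/d m x))%:E = ('d nu '/d m x).
  by rewrite fineK// Radon_Nikodym_fin_num.
have ih : m.-integrable setT (EFin \o (fun x => fine ('d nu '/d m x))).
  by apply: eq_integrable (Radon_Nikodym_integrable dom) => // x _ /=; rewrite hE.
exists (fun x => fine ('d nu '/d m x)) => // A mA.
rewrite /Rintegral fineK; last first.
  by apply: integrable_fin_num => //; exact: integrableS ih.
by rewrite (Radon_Nikodym_integral dom mA); apply: eq_integral => x _; rewrite hE.
Qed.

(** The sum [m] of the four Jordan parts dominates both the real and the imaginary
    charge, so the Radon-Nikodym theorem applies to each. *)
Lemma cmeasure_density (nu : cmeasure T R) :
  exists (m : {finite_measure set T -> \bar R}) (h : T -> R[i]),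
    cintegrable m setT h /\ forall A, measurable A -> cm_val nu A = cint m A h.
Proof.
have [P1 [N1 PN1]] := Hahn_decomposition (cm_re nu).
have [P2 [N2 PN2]] := Hahn_decomposition (cm_im nu).
have [v1 v1E] := finite_measure_add (jordan_pos PN1) (jordan_neg PN1).
have [v2 v2E] := finite_measure_add (jordan_pos PN2) (jordan_neg PN2).
have [m mE] := finite_measure_add v1 v2.
have le1 A : measurable A -> (`|cm_re nu A| <= m A)%E.
  move=> mA; rewrite mE measure_addE; apply: (@le_trans _ _ (v1 A)); last by rewrite leeDl.
  by rewrite v1E measure_addE; exact: abse_charge_variation.
have le2 A : measurable A -> (`|cm_im nu A| <= m A)%E.
  move=> mA; rewrite mE measure_addE; apply: (@le_trans _ _ (v2 A)); last by rewrite leeDr.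
  by rewrite v2E measure_addE; exact: abse_charge_variation.
have [h1 ih1 h1E] := charge_density_ex le1.
have [h2 ih2 h2E] := charge_density_ex le2.
exists m, (fun x => h1 x +i* h2 x); split; first by split.
by move=> A mA; rewrite /cm_val h1E// h2E.
Qed.

Context d' (T' : measurableType d').
Variables (m : {finite_measure set T' -> \bar R}) (I : Type) (s : seq I).
Variables (phi : I -> T' -> T) (g : I -> T' -> R[i]).
Hypothesis mphi : forall r, measurable_fun setT (phi r).
Hypothesis ig : forall r, cintegrable m setT (g r).

(** The integral of a complex measure can be computed from any presentation of the
    measure as a sum of images of densities. It consists of four real integrals, of
    products of a real or imaginary part of [f] with one of [g r]; these products are
    dominated by |f g|. *)
Lemma cintegral_density_sum (nu : cmeasure T R) D (f : T -> R[i]) :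
  (forall A, measurable A ->
    cm_val nu A = \sum_(r <- s) cint m (phi r @^-1` A) (g r)) ->
  measurable D -> measurable_fun setT f ->
  (forall r, cintegrable m (phi r @^-1` D) (fun x => f (phi r x) * g r x)) ->
  cintegral nu D f =
  \sum_(r <- s) cint m (phi r @^-1` D) (fun x => f (phi r x) * g r x).
Proof.
move=> nuE mD mf ifg.
have [fr fi] := (measurable_complexP f).1 mf.
have mg r := cintegrable_measurable (ig r).
have mpD r := measurable_preimage (mphi r) mD.
have mprod r (u v : R[i] -> R) : measurable_fun setT u -> measurable_fun setT v ->
    (forall z, `|u z| <= Normc.normc z) -> (forall z, `|v z| <= Normc.normc z) ->
    m.-integrable (phi r @^-1` D) (fun x => (u (f (phi r x)) * v (g r x))%:E).
  move=> mu mv un vn.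
  have mfg : measurable_fun setT (fun x => f (phi r x) * g r x).
    by apply: measurable_cplxM (mg r); exact: measurableT_comp mf _.
  apply: le_integrable (integrable_normc (mpD r) mfg (ifg r)) => //.
    apply/measurable_EFinP/measurable_funTS; apply: measurable_funM.
      by apply: measurableT_comp mu _; exact: measurableT_comp mf _.
    exact: measurableT_comp mv (mg r).
  move=> x _ /=; rewrite lee_fin normrM Normc.normcM.
  by rewrite [leRHS]ger0_norm ?mulr_ge0 ?normc_ge0// ler_pM.
have mRe := @measurable_Re R; have mIm := @measurable_Im R.
have nRe := @normRe_le_normc R; have nIm := @normIm_le_normc R.
have reE A : measurable A -> cm_re nu A =
    (\sum_(r <- s) \int[m]_(x in phi r @^-1` A) complex.Re (g r x))%:E.
  move=> mA; rewrite -[LHS]fineK ?fin_num_measure//; congr EFin.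
  by have := congr1 (@complex.Re R) (nuE _ mA); rewrite Re_sum.
have imE A : measurable A -> cm_im nu A =
    (\sum_(r <- s) \int[m]_(x in phi r @^-1` A) complex.Im (g r x))%:E.
  move=> mA; rewrite -[LHS]fineK ?fin_num_measure//; congr EFin.
  by have := congr1 (@complex.Im R) (nuE _ mA); rewrite Im_sum.
have igr r := (ig r).1; have igi r := (ig r).2.
rewrite /cintegral.
rewrite !(charge_integral_density_sum mphi igr reE mD)//;
  try by move=> r; exact: mprod.
rewrite !(charge_integral_density_sum mphi igi imE mD)//;
  try by move=> r; exact: mprod.
apply: complex_eqP.
  rewrite Re_sum /= -sumrB; apply: eq_bigr => r _.
  rewrite -RintegralB//; [|exact: mprod|exact: mprod].
  by apply: eq_Rintegral => x _; case: (f _) (g _ _) => ? ? [].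
rewrite Im_sum /= -big_split; apply: eq_bigr => r _ /=.
rewrite addrC -RintegralD//; [|exact: mprod|exact: mprod].
by apply: eq_Rintegral => x _; case: (f _) (g _ _) => ? ? [? ?] /=; rewrite addrC.
Qed.

Lemma cmeasure_density_sum : exists nu : cmeasure T R, forall A, measurable A ->
  cm_val nu A = \sum_(r <- s) cint m (phi r @^-1` A) (g r).
Proof.
have [re reE] := charge_density_sum s mphi (fun r => (ig r).1).
have [im imE] := charge_density_sum s mphi (fun r => (ig r).2).
exists (CMeasure re im) => A mA; rewrite /cm_val/= reE// imE//=.
by apply: complex_eqP; rewrite ?Re_sum ?Im_sum.
Qed.

End cmeasure_density.

(** * Total variation *)

Section total_variation.
Context d (T : measurableType d) (R : realType).
Implicit Types (nu : cmeasure T R) (D : set T).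

Lemma Re_norm (z : R[i]) : complex.Re `|z| = Normc.normc z.
Proof. by []. Qed.

Lemma cm_val0 nu : cm_val nu set0 = 0.
Proof. by rewrite /cm_val !charge0. Qed.

Lemma total_variation_ge nu A B : measurable A -> measurable B ->
  A `&` B = set0 ->
  ((Normc.normc (cm_val nu A) + Normc.normc (cm_val nu B))%:E
    <= total_variation nu (A `|` B))%E.
Proof.
move=> mA mB AB0.
pose F : (set T)^nat := bigcup2 A B.
apply: (@le_trans _ _ (\sum_(0 <= k <oo) (complex.Re `|cm_val nu (F k)|)%:E)%E).
  apply: le_trans (nneseries_lim_ge 2 _) => [|k _ _].
    by rewrite big_nat_recr//= big_nat1.
  by rewrite lee_fin Re_norm normc_ge0.
apply: ereal_sup_ubound; exists F => //; split.
- by move=> [|[|k]] //=; exact: measurable0.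
- by rewrite -trivIset_bigcup2.
- by rewrite bigcup2E.
Qed.

Lemma total_variation_le nu (mu : {measure set T -> \bar R}) :
    (forall A, measurable A -> (Normc.normc (cm_val nu A))%:E <= mu A)%E ->
  forall A, (total_variation nu A <= mu A)%E.
Proof.
move=> numu A; apply: ge_ereal_sup => _ [F [mF tF <-] <-].
rewrite measure_bigcup// [X in (_ <= X)%E](@eq_eseriesl _ _ xpredT); last first.
  by move=> k; exact: in_setT.
apply: lee_nneseries => k _.
  by rewrite lee_fin Re_norm normc_ge0.
exact: numu.
Qed.

Lemma total_variation0 nu : total_variation nu set0 = 0%E.
Proof.
apply/eqP; rewrite eq_le; apply/andP; split.
  apply: ge_ereal_sup => _ [F [mF tF F0] <-].
  rewrite eseries0// => k _ _.
  suff -> : F k = set0 by rewrite cm_val0 Re_norm Normc.normc0.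
  by apply/seteqP; split => // x Fx; rewrite -F0; exists k.
have := @total_variation_ge nu set0 set0 measurable0 measurable0 (setI0 _).
by rewrite setU0; apply: le_trans; rewrite lee_fin addr_ge0// normc_ge0.
Qed.

(** Cut [A] according to the sign of [h]: over each of the two pieces the integral of
    |h| is up to sign that of [h], hence at most the modulus of [nu] of the piece. The
    hypothesis holds when [h] is the real or imaginary part of a density of [nu]. *)
Lemma Rintegral_abs_le_total_variation nu (m : {finite_measure set T -> \bar R})
    (h : T -> R) :
  m.-integrable setT (EFin \o h) ->
  (forall A, measurable A ->
     `|\int[m]_(x in A) h x| <= Normc.normc (cm_val nu A)) ->
  forall A, measurable A ->
    (0 <= (\int[m]_(x in A) `|h x|)%:E <= total_variation nu A)%E.
Proof.
move=> ih hnu A mA; rewrite lee_fin Rintegral_ge0//=.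
pose B := A `&` [set x | 0 <= h x]; pose C := A `&` ~` [set x | 0 <= h x].
have mh : measurable_fun setT h by exact/measurable_EFinP/measurable_int/ih.
have mH : measurable [set x | 0 <= h x].
  rewrite -[X in measurable X]setTI (_ : [set x | _] = h @^-1` `[0, +oo[).
    exact: mh.
  by apply/seteqP; split => x /=; rewrite in_itv/= andbT.
have mB : measurable B by exact: measurableI.
have mC : measurable C by apply: measurableI => //; exact: measurableC.
have AE : A = B `|` C by rewrite -setIUr setUv setIT.
have BC0 : B `&` C = set0 by rewrite setIACA setICr setI0.
have ihS E : measurable E -> m.-integrable E (EFin \o h).
  by move=> mE; apply: (integrableS _ _ _ ih).
rewrite AE; apply: le_trans (total_variation_ge nu mB mC BC0).
rewrite lee_fin Rintegral_setU//; last 2 first.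
- by rewrite -AE; exact: (integrable_norm (ihS _ mA)).
- exact/disj_set2P.
apply: lerD; apply: le_trans (hnu _ _) => //.
  rewrite (@eq_Rintegral _ _ _ _ _ h) ?ler_norm// => x.
  by rewrite inE => -[_ /= hx]; rewrite ger0_norm.
rewrite -normrN (@eq_Rintegral _ _ _ _ _ (fun x => - h x)); last first.
  move=> x; rewrite inE => -[_ /= /negP]; rewrite -ltNge => /ltW hx.
  by rewrite ler0_norm.
rewrite (_ : \int[m]_(x in C) - h x = - \int[m]_(x in C) h x) ?ler_norm//.
rewrite -[RHS]mulN1r -RintegralZl//; last exact: ihS.
by apply: eq_Rintegral => x _; rewrite mulN1r.
Qed.

End total_variation.

Section weighted_total_variation.
Context d (T : measurableType d) (R : realType).
Variables (nu : cmeasure T R) (w : T -> R) (D : set T).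
Hypotheses (mw : measurable_fun setT w) (w0 : forall x, 0 <= w x).
Hypothesis mD : measurable D.

(** The measure of density |h| is below the total variation of [nu]. *)
Lemma weighted_integrable (m : {finite_measure set T -> \bar R}) (h : T -> R) :
  m.-integrable setT (EFin \o h) ->
  (forall A, measurable A ->
     `|\int[m]_(x in A) h x| <= Normc.normc (cm_val nu A)) ->
  (\int[total_variation nu]_(x in D) (w x)%:E < +oo)%E ->
  m.-integrable D (fun x => (w x * h x)%:E).
Proof.
move=> ih hnu wfin.
have mh : measurable_fun setT h by exact/measurable_EFinP/measurable_int/ih.
have iah := integrable_norm ih.
have mwh : measurable_fun D (fun x => (w x * h x)%:E).
  by apply/measurable_EFinP/measurable_funTS; exact: measurable_funM.
have mEw : measurable_fun D (EFin \o w) by exact/measurable_EFinP/measurable_funTS.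
apply/integrableP; split => //; apply: le_lt_trans wfin.
have -> : (\int[m]_(x in D) `|(w x * h x)%:E| =
    \int[density iah (fun x => normr_ge0 (h x))]_(x in D) (w x)%:E)%E.
  rewrite ge0_integral_density//.
  by apply: eq_integral => x _; rewrite /= normrM (ger0_norm (w0 x)) EFinM.
apply: le_setfun_integral => //.
- exact: total_variation0.
- move=> A mA; have := Rintegral_abs_le_total_variation ih hnu mA.
  rewrite /Rintegral fineK//; apply: integrable_fin_num => //.
  by apply: (integrableS _ _ _ iah).
- by move=> x _; rewrite lee_fin.
Qed.

Lemma weighted_cintegrable (m : {finite_measure set T -> \bar R}) (h : T -> R[i]) :
  cintegrable m setT h ->
  (forall A, measurable A -> cm_val nu A = cint m A h) ->
  (\int[total_variation nu]_(x in D) (w x)%:E < +oo)%E ->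
  cintegrable m D (fun x => (w x)%:C * h x).
Proof.
move=> [ir ii] nuE wfin; split.
  apply: (@eq_integrable _ _ _ _ _ _ (fun x => (w x * complex.Re (h x))%:E)) => //.
    by move=> x _; case: (h x) => ? ? /=; rewrite mul0r subr0.
  apply: weighted_integrable => // A mA; rewrite nuE//.
  exact: le_trans (normRe_le_normc (cint m A h)).
apply: (@eq_integrable _ _ _ _ _ _ (fun x => (w x * complex.Im (h x))%:E)) => //.
  by move=> x _; case: (h x) => ? ? /=; rewrite mul0r addr0.
apply: weighted_integrable => // A mA; rewrite nuE//.
exact: le_trans (normIm_le_normc (cint m A h)).
Qed.

Context d' (T' : measurableType d').
Variables (m : {finite_measure set T' -> \bar R}) (phi : T' -> T) (g : T' -> R[i]).

(** The density |Re g| + |Im g| bounds the total variation, and is at most 2 |g|. *)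
Lemma total_variation_weight_lty :
  measurable_fun setT phi -> cintegrable m setT g ->
  (forall A, measurable A -> cm_val nu A = cint m (phi @^-1` A) g) ->
  m.-integrable (phi @^-1` D) (fun x => (w (phi x) * Normc.normc (g x))%:E) ->
  (\int[total_variation nu]_(x in D) (w x)%:E < +oo)%E.
Proof.
move=> mphi ig nuE iwg; have mg := cintegrable_measurable ig.
have [igr igi] := ig; have mpD := measurable_preimage mphi mD.
pose k x := `|complex.Re (g x)| + `|complex.Im (g x)|.
have ik : m.-integrable setT (EFin \o k).
  exact: eq_integrable (integrableD measurableT
    (integrable_norm igr) (integrable_norm igi)).
have k0 x : 0 <= k x by rewrite addr_ge0.
have iwk : m.-integrable (phi @^-1` D) (fun x => (w (phi x) * k x)%:E).
  apply: le_integrable (integrableZl mpD 2 iwg) => //.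
    apply/measurable_EFinP/measurable_funTS; apply: measurable_funM.
      exact: measurableT_comp mw mphi.
    exact/measurable_EFinP/measurable_int/ik.
  move=> x _ /=; rewrite lee_fin ger0_norm ?mulr_ge0//.
  rewrite ger0_norm ?mulr_ge0 ?normc_ge0// mulrCA ler_wpM2l//.
  by rewrite mulr2n mulrDl mul1r lerD ?normRe_le_normc ?normIm_le_normc.
have [mu [muE iw _]] := density_pushforward k0 ik mphi mD mw iwk.
apply: (@le_lt_trans _ _ (\int[mu]_(x in D) (w x)%:E)%E).
  apply: le_setfun_integral => //.
  - exact: total_variation0.
  - move=> A mA; apply/andP; split.
      have := total_variation_ge nu mA measurable0 (setI0 _).
      by rewrite setU0; apply: le_trans; rewrite lee_fin addr_ge0// normc_ge0.
    apply: total_variation_le => B mB; rewrite nuE//.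
    rewrite (muE B mB : (mu : {measure set T -> \bar R}) B = _) lee_fin.
    have mpB := measurable_preimage mphi mB.
    have ikS : m.-integrable (phi @^-1` B) (EFin \o k).
      by apply: (integrableS _ _ _ ik).
    have irS := integrableS measurableT mpB (@subsetT _ _) igr.
    have iiS := integrableS measurableT mpB (@subsetT _ _) igi.
    apply: le_trans (normc_le_ReIm _) _; rewrite /k RintegralD//; last 2 first.
    - exact: (integrable_norm irS).
    - exact: (integrable_norm iiS).
    by rewrite lerD// le_normr_Rintegral.
  - by move=> x _; rewrite lee_fin.
have /integrableP[_] := iw; apply: le_lt_trans.
rewrite le_eqVlt; apply/orP; left; apply/eqP/eq_integral => x _ /=.
by rewrite ger0_norm.
Qed.

End weighted_total_variation.

(** * A polynomial cut-off *)

Section cutoff.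
Variable R : realType.
Implicit Types (x y t h : R) (n : nat).

Lemma bernoulli_ge t n : 0 <= t -> 1 + n%:R * t <= (1 + t) ^+ n.
Proof.
move=> t0; elim: n => [|n IHn]; first by rewrite mul0r addr0 expr0.
rewrite exprS; apply: (@le_trans _ _ ((1 + t) * (1 + n%:R * t))).
  by have := mulr_ge0 t0 (mulr_ge0 (ler0n R n) t0); rewrite -natr1; lra.
by rewrite ler_wpM2l// addr_ge0.
Qed.

Lemma bernoulli_le t n : 0 <= t <= 1 -> 1 - n%:R * t <= (1 - t) ^+ n.
Proof.
move=> /andP[t0 t1]; elim: n => [|n IHn]; first by rewrite mul0r subr0 expr0.
rewrite exprS; apply: (@le_trans _ _ ((1 - t) * (1 - n%:R * t))).
  by have := mulr_ge0 t0 (mulr_ge0 (ler0n R n) t0); rewrite -natr1; lra.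
by rewrite ler_wpM2l// subr_ge0.
Qed.

(** Polynomials that converge boundedly on ]0, 1] to the indicator function of
    y < 1/2. With t = y^(2n) and m = n 4^n, Bernoulli's inequality gives
    1 - m t <= (1 - t)^m <= 1 / (1 + m t), where m t = n (2y)^(2n). If y >= 1/2, this
    is at least n: the factor n in m is there to get the limit 0 at y = 1/2 too. If
    y < 1/2, it tends to 0, the exponent 2n (and not n) making an easy bound such as
    (2y)^n = O(1/n) sufficient. *)
Definition cutoff n y := (1 - y ^+ (2 * n)) ^+ (n * 4 ^ n).

Lemma cutoff_itv n y : 0 <= y <= 1 -> 0 <= cutoff n y <= 1.
Proof.
move=> /andP[y0 y1]; have t0 : 0 <= y ^+ (2 * n) by rewrite exprn_ge0.
have t1 : y ^+ (2 * n) <= 1 by rewrite exprn_ile1.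
by rewrite exprn_ge0 ?subr_ge0//= exprn_ile1 ?subr_ge0// gerBl.
Qed.

Lemma cutoff_le n y : 2^-1 <= y <= 1 -> cutoff n y <= n.+1%:R^-1.
Proof.
move=> /andP[y2 y1]; have y0 : 0 <= y by apply: le_trans y2; rewrite invr_ge0.
set t := y ^+ (2 * n); have t0 : 0 <= t by rewrite exprn_ge0.
have t1 : t <= 1 by rewrite exprn_ile1.
have mt : n%:R <= (n * 4 ^ n)%:R * t.
  rewrite natrM -mulrA ler_peMr// /t exprM natrX -exprMn exprn_ege1//.
  have : 2^-1 * 2^-1 <= y * y by rewrite ler_pM// invr_ge0.
  by rewrite expr2; lra.
rewrite /cutoff -/t -[leRHS]mul1r ler_pdivlMr//.
apply: (@le_trans _ _ ((1 - t) ^+ (n * 4 ^ n) * (1 + t) ^+ (n * 4 ^ n))).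
  apply: ler_wpM2l; first by rewrite exprn_ge0// subr_ge0.
  by apply: le_trans (bernoulli_ge _ t0); rewrite -natr1 addrC lerD2l.
rewrite -exprMn exprn_ile1//; first by rewrite mulr_ge0 ?subr_ge0 ?addr_ge0.
by have := mulr_ge0 t0 t0; lra.
Qed.

Lemma cutoff_ge y : 0 < y < 2^-1 ->
  exists2 c, 0 < c & forall n, 1 - c * n.+1%:R^-1 <= cutoff n y.
Proof.
move=> /andP[y0 y2].
pose h := (2 * y)^-1 - 1; pose c := Num.min 1 h.
have z0 : 0 < 2 * y by rewrite mulr_gt0.
have h0 : 0 < h by rewrite subr_gt0 invf_gt1//; lra.
have c0 : 0 < c by rewrite lt_min ltr01.
(* As (2y)^-1 = 1 + h, Bernoulli's inequality gives
   (2y)^n <= 1 / (1 + n h) <= 1 / (c (n + 1)). *)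
exists (c ^- 2) => [|n]; first by rewrite invr_gt0 exprn_gt0.
set t := y ^+ (2 * n); have t0 : 0 <= t by rewrite exprn_ge0// ltW.
have t1 : t <= 1 by rewrite exprn_ile1//; lra.
apply: le_trans (bernoulli_le _ _); last by rewrite t0 t1.
rewrite lerD2l lerN2.
have zn : (2 * y) ^+ n <= (c * n.+1%:R)^-1.
  rewrite -[X in X ^+ n]invrK exprVn lef_pV2 ?posrE; last 2 first.
  - by rewrite exprn_gt0// invr_gt0.
  - by rewrite mulr_gt0.
  have -> : (2 * y)^-1 = 1 + h by rewrite /h addrC subrK.
  apply: le_trans (bernoulli_ge _ (ltW h0)).
  have c1 : c <= 1 by rewrite ge_min lexx.
  have ch : c <= h by rewrite ge_min lexx orbT.
  by rewrite -natr1 mulrDr mulr1 addrC lerD// mulrC ler_wpM2l.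
rewrite natrM -mulrA.
have -> : (4 ^ n)%:R * t = (2 * y) ^+ n * (2 * y) ^+ n :> R.
  rewrite /t exprM natrX -!exprMn; congr (_ ^+ _); ring.
have zn0 : 0 <= (2 * y) ^+ n by rewrite exprn_ge0// ltW.
apply: (@le_trans _ _ (n%:R * ((c * n.+1%:R)^-1 * (c * n.+1%:R)^-1))).
  by rewrite ler_wpM2l// ler_pM.
have -> : n%:R * ((c * n.+1%:R)^-1 * (c * n.+1%:R)^-1) =
    c ^- 2 * (n%:R * n.+1%:R^-1 * n.+1%:R^-1) :> R.
  by rewrite invfM -exprVn; ring.
rewrite ler_wpM2l ?invr_ge0 ?exprn_ge0 ?(ltW c0)//.
by rewrite ler_piMl ?invr_ge0// ler_pdivrMr// mul1r ler_nat.
Qed.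

Lemma cvg_cutoff_lt y : 0 < y < 2^-1 -> cutoff n y @[n --> \oo] --> (1 : R).
Proof.
move=> y2; have [c c0 cE] := cutoff_ge y2.
apply: (@squeeze_cvgr _ _ _ _ (fun n => 1 - c * n.+1%:R^-1) (fun=> 1)).
- near=> n; rewrite cE/=.
  have /andP[y0 y1] := y2.
  by have /andP[] // : 0 <= cutoff n y <= 1 by apply: cutoff_itv; lra.
- rewrite -[X in _ --> X]subr0; apply: cvgB; first exact: cvg_cst.
  by rewrite -[X in _ --> X](mulr0 c); apply: cvgMr; exact: cvg_harmonic.
- exact: cvg_cst.
Unshelve. all: by end_near. Qed.

Lemma cvg_cutoff_ge y : 2^-1 <= y <= 1 -> cutoff n y @[n --> \oo] --> (0 : R).
Proof.
move=> y2.
apply: (@squeeze_cvgr _ _ _ _ (fun=> 0) (fun n => n.+1%:R^-1)).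
- near=> n; rewrite cutoff_le// andbT.
  have /andP[y0 y1] := y2.
  by have /andP[] // : 0 <= cutoff n y <= 1 by apply: cutoff_itv; lra.
- exact: cvg_cst.
- exact: cvg_harmonic.
Unshelve. all: by end_near. Qed.

End cutoff.

(** * A complex measure on a bounded interval is determined by its moments *)

Section moment_problem.
Variables (R : realType) (R0 : R).
Hypothesis R0_ge0 : 0 <= R0.
Implicit Types m mu : {finite_measure set R -> \bar R}.

Lemma measurable_bounded_cc : measurable (`[0, R0]%classic : set R).
Proof. exact: measurable_itv. Qed.
Hint Resolve measurable_bounded_cc : core.

Lemma integrable_pow m k : m.-integrable `[0, R0] (fun x : R => (x ^+ k)%:E).
Proof.
apply: (@le_integrable _ _ _ _ _ _ _ (EFin \o cst (R0 ^+ k))) => //.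
- by apply/measurable_EFinP/measurable_funTS; exact: exprn_measurable.
- move=> x /=; rewrite in_itv/= => /andP[x0 xR0]; rewrite lee_fin !ger0_norm ?exprn_ge0//.
  by rewrite lerXn2r// nnegrE.
- exact: finite_measure_integrable_cst.
Qed.

Lemma moment_poly m1 m2 :
  (forall k, \int[m1]_(x in `[0, R0]) x ^+ k = \int[m2]_(x in `[0, R0]) x ^+ k) ->
  forall p : {poly R},
  \int[m1]_(x in `[0, R0]) p.[x] = \int[m2]_(x in `[0, R0]) p.[x].
Proof.
move=> m12 p.
(* The factor x^k makes room for the multiplication by 'X in the induction. *)
suff /(_ 0%N) [_ [_]] : forall k,
  m1.-integrable `[0, R0] (fun x : R => (x ^+ k * p.[x])%:E) /\
  m2.-integrable `[0, R0] (fun x : R => (x ^+ k * p.[x])%:E) /\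
  \int[m1]_(x in `[0, R0]) (x ^+ k * p.[x]) = \int[m2]_(x in `[0, R0]) (x ^+ k * p.[x]).
  by under eq_Rintegral do rewrite expr0 mul1r;
     under [RHS]eq_Rintegral do rewrite expr0 mul1r.
elim/poly_ind: p => [|p c IHp] k.
  have e0 : (fun x : R => (x ^+ k * (0 : {poly R}).[x])%:E) = cst 0%E.
    by apply/funext => x; rewrite horner0 mulr0.
  rewrite /Rintegral e0 !integral0; do 2?split=> //; exact: integrable0.
have [i1 [i2 e12]] := IHp k.+1.
have j1 := integrableZl measurable_bounded_cc c (integrable_pow m1 k).
have j2 := integrableZl measurable_bounded_cc c (integrable_pow m2 k).
have pE x : x ^+ k * (p * 'X + c%:P).[x] = x ^+ k.+1 * p.[x] + c * x ^+ k.
  by rewrite !hornerE exprS; ring.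
have fE : (fun x : R => (x ^+ k * (p * 'X + c%:P).[x])%:E) =
    (fun x : R => (x ^+ k.+1 * p.[x])%:E) \+ (fun x : R => c%:E * (x ^+ k)%:E)%E.
  by apply/funext => x; rewrite pE.
rewrite fE; split; first exact: integrableD.
split; first exact: integrableD.
under eq_Rintegral do rewrite pE; under [RHS]eq_Rintegral do rewrite pE.
rewrite !RintegralD// e12; congr (_ + _).
by rewrite !RintegralZl ?m12//; exact: integrable_pow.
Qed.

(** Dominated convergence: the affine change of variable sends [0, R0] into ]0, 1]
    and [a] to 1/2. *)
Lemma cvg_cutoff_integral m a : 0 <= a <= R0 ->
  \int[m]_(x in `[0, R0]) cutoff n (2^-1 + (x - a) / (2 * (R0 + 1)))
    @[n --> \oo] --> fine (m `[0, a[%classic).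
Proof.
move=> /andP[a0 aR].
pose y (x : R) := 2^-1 + (x - a) / (2 * (R0 + 1)).
have R01 : 0 < 2 * (R0 + 1) by rewrite mulr_gt0// ltr_wpDl.
have y01 x : 0 <= x <= R0 -> 0 < y x <= 1.
  move=> /andP[x0 xR]; apply/andP; split.
    rewrite /y -ltrBlDl sub0r ltr_pdivlMr//; lra.
  rewrite /y -lerBrDl ler_pdivrMr//; lra.
have my : measurable_fun setT y.
  apply: measurable_funD => //; apply: measurable_funM => //.
  exact: measurable_funB.
have mc n : measurable_fun setT (fun x => cutoff n (y x)).
  apply: measurable_funX; apply: measurable_funB => //.
  exact: measurable_funX.
have mA : measurable (`[0, a[%classic : set R) by exact: measurable_itv.
pose f_ n x := (cutoff n (y x))%:E.
have mf_ n : measurable_fun `[0, R0]%classic (f_ n).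
  exact/measurable_EFinP/measurable_funTS.
pose ind : R -> R := \1_(`[0, a[%classic : set R).
have mind : measurable_fun `[0, R0]%classic (EFin \o ind).
  by apply/measurable_EFinP; exact: measurable_indic.
have cvgf : {ae m, forall x, `[0, R0]%classic x ->
    f_ n x @[n --> \oo] --> (EFin \o ind) x}.
  apply: aeW => x; rewrite /= in_itv/= => x0R; apply: cvg_EFin; first by near=> n.
  have /andP[yx0 yx1] := y01 _ x0R; have /andP[x0 xR] := x0R.
  rewrite /= /ind indicE; case: (ltP x a) => xa.
    rewrite mem_set/= ?in_itv/= ?x0 ?xa//; apply: cvg_cutoff_lt; rewrite yx0/=.
    by rewrite /y -ltrBrDl subrr ltr_pdivrMr// mul0r subr_lt0.
  rewrite memNset/=; last by rewrite in_itv/= x0/=; apply/negP; rewrite -leNgt.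
  apply: cvg_cutoff_ge; rewrite yx1 andbT.
  by rewrite /y lerDl divr_ge0 ?subr_ge0// ltW.
have bound : {ae m, forall x n, `[0, R0]%classic x -> (`|f_ n x| <= cst 1 x)%E}.
  apply: aeW => x n; rewrite /= in_itv/= => x0R; rewrite lee_fin.
  have /andP[yx0 yx1] := y01 _ x0R.
  have /andP[c0 c1] : 0 <= cutoff n (y x) <= 1 by apply: cutoff_itv; rewrite yx1 ltW.
  by rewrite ger0_norm.
have icst : m.-integrable `[0, R0]%classic (cst 1%E).
  exact: finite_measure_integrable_cst.
have [_ _] := dominated_convergence measurable_bounded_cc mf_ mind cvgf icst bound.
rewrite [X in _ --> X](_ : _ = m `[0, a[%classic); last first.
  rewrite integral_indic// setIidl// => x /=; rewrite !in_itv/= => /andP[-> xa] /=.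
  by rewrite (le_trans (ltW xa)).
rewrite -[X in _ --> X -> _]fineK ?fin_num_measure//.
exact: fine_cvg.
Unshelve. all: by end_near. Qed.

(** By the previous lemma, moments determine the masses of the intervals [0, a[, and
    half-lines form a family stable under intersection that generates the Borel
    sets. *)
Lemma moment_unique m1 m2 :
  m1 (~` `[0, R0]%classic) = 0%E -> m2 (~` `[0, R0]%classic) = 0%E ->
  (forall k, \int[m1]_(x in `[0, R0]) x ^+ k = \int[m2]_(x in `[0, R0]) x ^+ k) ->
  forall A, measurable A -> m1 A = m2 A.
Proof.
move=> m10 m20 m12.
have mC : measurable (~` `[0, R0]%classic : set R) by exact: measurableC.
have sub0 m A : m (~` `[0, R0]%classic) = 0%E -> measurable A ->
    m A = m (A `&` `[0, R0]%classic).
  move=> m0 mA; rewrite -[in LHS](setIT A) -(setUv `[0, R0]%classic) setIUr.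
  rewrite measureU//; [|exact: measurableI|exact: measurableI|]; last first.
    by rewrite setIACA setICr setI0.
  rewrite [X in (_ + X)%E](_ : _ = 0%E) ?adde0//; apply/eqP.
  rewrite eq_le measure_ge0 andbT -m0.
  by rewrite le_measure ?inE//; exact: measurableI.
have half a : 0 <= a <= R0 -> m1 `[0, a[%classic = m2 `[0, a[%classic.
  move=> a0R; rewrite -[LHS]fineK ?fin_num_measure// -[RHS]fineK ?fin_num_measure//.
  rewrite -(cvg_lim (@Rhausdorff R) (@cvg_cutoff_integral m1 a a0R)).
  rewrite -(cvg_lim (@Rhausdorff R) (@cvg_cutoff_integral m2 a a0R)).
  congr (_%:E); congr (lim (_ @ \oo)).
  apply/funext => n.
  pose Y : {poly R} := (2^-1 - a / (2 * (R0 + 1)))%:P + (2 * (R0 + 1))^-1 *: 'X.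
  pose p : {poly R} := (1 - Y ^+ (2 * n)) ^+ (n * 4 ^ n).
  have pE x : cutoff n (2^-1 + (x - a) / (2 * (R0 + 1))) = p.[x].
    rewrite /cutoff /p !hornerE; congr ((1 - _ ^+ _) ^+ _).
    by rewrite mulrBl mulrC; ring.
  under eq_Rintegral do rewrite pE; under [RHS]eq_Rintegral do rewrite pE.
  exact: moment_poly.
have total : m1 `[0, R0]%classic = m2 `[0, R0]%classic.
  have := m12 0%N; under eq_Rintegral do rewrite expr0.
  under [RHS]eq_Rintegral do rewrite expr0.
  rewrite !Rintegral_cst// !mul1r => h.
  by rewrite -[LHS]fineK ?fin_num_measure// h fineK ?fin_num_measure.
apply: (measure_unique (@RGenInftyO.G R) (fun n => `]-oo, n%:R[%classic)).
- exact: RGenInftyO.measurableE.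
- move=> _ _ [x ->] [y ->]; exists (Num.min x y).
  by apply/seteqP; split => z /=; rewrite !in_itv/= lt_min => /andP.
- by move=> n; exists n%:R.
- apply/seteqP; split => // x _; exists (Num.bound `|x|) => //=.
  by rewrite in_itv/= (le_lt_trans (ler_norm _))// archi_boundP.
- move=> _ [a ->]; have mIa : measurable (`]-oo, a[%classic : set R) by [].
  apply: etrans (sub0 m1 _ m10 mIa) (etrans _ (esym (sub0 m2 _ m20 mIa))).
  have [a0|a0] := leP a 0.
    rewrite (_ : _ `&` _ = set0) ?measure0//; apply/seteqP; split => // x [] /=.
    rewrite !in_itv/= => xa /andP[x0 _].
    by move: (le_lt_trans x0 (lt_le_trans xa a0)); rewrite ltxx.
  have [aR|aR] := leP a R0.
    rewrite (_ : _ `&` _ = `[0, a[%classic) ?half ?aR ?(ltW a0)//.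
    apply/seteqP; split => x /=; rewrite !in_itv/=.
      by move=> [xa /andP[-> _]].
    by move=> /andP[-> xa]; rewrite xa (le_trans (ltW xa)).
  rewrite (_ : _ `&` _ = `[0, R0]%classic)//.
  apply/seteqP; split => x /=; rewrite !in_itv/=; first by case.
  by move=> /andP[-> xR]; rewrite xR (le_lt_trans xR).
- by move=> k; rewrite ltey_eq fin_num_measure.
Qed.

Lemma jordan_concentrated (nu : {charge set R -> \bar R}) P N
    (PN : hahn_decomposition nu P N) :
  (forall A, measurable A -> A `&` `[0, R0]%classic = set0 -> nu A = 0%E) ->
  jordan_pos PN (~` `[0, R0]%classic) = 0%E /\
  jordan_neg PN (~` `[0, R0]%classic) = 0%E.
Proof.
move=> nu0; have [[mP _] [mN _] _ _] := PN.
have mC : measurable (~` `[0, R0]%classic : set R) by exact: measurableC.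
split.
  rewrite jordan_posE cjordan_posE /crestr0 mem_set//= /crestr nu0//.
    exact: measurableI.
  by rewrite setIAC setICl set0I.
rewrite jordan_negE cjordan_negE /crestr0 mem_set//= /crestr nu0 ?oppe0//.
  exact: measurableI.
by rewrite setIAC setICl set0I.
Qed.

Lemma measure_add_eq0 (m1 m2 : {measure set R -> \bar R}) A :
  m1 A = 0%E -> m2 A = 0%E -> measure_add m1 m2 A = 0%E.
Proof. by move=> m10 m20; rewrite measure_addE m10 m20 adde0. Qed.

(** If p1 - n1 and p2 - n2 are the Jordan decompositions, the positive measures
    p1 + n2 and p2 + n1 have the same moments. *)
Lemma charge_moment_unique (nu1 nu2 : {charge set R -> \bar R}) :
  (forall A, measurable A -> A `&` `[0, R0]%classic = set0 -> nu1 A = 0%E) ->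
  (forall A, measurable A -> A `&` `[0, R0]%classic = set0 -> nu2 A = 0%E) ->
  (forall k, charge_integral nu1 `[0, R0] (fun x => x ^+ k) =
             charge_integral nu2 `[0, R0] (fun x => x ^+ k)) ->
  forall A, measurable A -> nu1 A = nu2 A.
Proof.
move=> c1 c2; rewrite /charge_integral.
move: (svalP (hahn_split nu1)) (svalP (hahn_split nu2)) => PN1 PN2 nu12 A mA.
have [p1 n1] := jordan_concentrated PN1 c1.
have [p2 n2] := jordan_concentrated PN2 c2.
have [a aE] := finite_measure_add (jordan_pos PN1) (jordan_neg PN2).
have [b bE] := finite_measure_add (jordan_pos PN2) (jordan_neg PN1).
have a0 : a (~` `[0, R0]%classic) = 0%E by rewrite aE; exact: measure_add_eq0 p1 n2.
have b0 : b (~` `[0, R0]%classic) = 0%E by rewrite bE; exact: measure_add_eq0 p2 n1.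
have ab : forall k,
    \int[a]_(x in `[0, R0]) x ^+ k = \int[b]_(x in `[0, R0]) x ^+ k.
  move=> k.
  transitivity (\int[measure_add (jordan_pos PN1) (jordan_neg PN2)]_(x in `[0, R0])
    x ^+ k).
    by apply: eq_measure_Rintegral => B _; exact: (congr1 (@^~ B) aE).
  transitivity (\int[measure_add (jordan_pos PN2) (jordan_neg PN1)]_(x in `[0, R0])
    x ^+ k); last first.
    by apply: eq_measure_Rintegral => B _; exact: (esym (congr1 (@^~ B) bE)).
  rewrite !Rintegral_measure_add//; try exact: integrable_pow.
  by have := nu12 k; lra.
have := moment_unique a0 b0 ab mA; rewrite aE bE !measure_addE => h.
rewrite (jordan_pos_neg PN1)// (jordan_pos_neg PN2)//.
rewrite -[X in (_ - X)%E]oppeK -[X in _ = (_ - X)%E]oppeK.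
apply: fin_num_sub_exchange; rewrite ?fin_numN ?fin_num_measure//.
by rewrite !oppeK.
Qed.

Lemma cmeasure_moment_unique (nu1 nu2 : cmeasure R R) (Lambda : {poly R[i]} -> R[i]) :
  represents (fun x : R => x%:C) nu1 `[0, R0] Lambda ->
  represents (fun x : R => x%:C) nu2 `[0, R0] Lambda ->
  forall A, measurable A -> cm_val nu1 A = cm_val nu2 A.
Proof.
move=> [c1 l1] [c2 l2].
have charge0_int (nu : {charge set R -> \bar R}) : charge_integral nu `[0, R0] (fun=> 0) = 0.
  by rewrite /charge_integral /Rintegral !integral0_eq// subrr.
have cE (nu : cmeasure R R) k : cintegral nu `[0, R0] (fun x => x%:C ^+ k) =
    charge_integral (cm_re nu) `[0, R0] (fun x => x ^+ k) +i*
    charge_integral (cm_im nu) `[0, R0] (fun x => x ^+ k).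
  rewrite /cintegral.
  have -> : (fun x : R => complex.Re (x%:C ^+ k)) = (fun x => x ^+ k).
    by apply/funext => x; rewrite -rmorphXn.
  have -> : (fun x : R => complex.Im (x%:C ^+ k)) = (fun=> 0).
    by apply/funext => x; rewrite -rmorphXn.
  by rewrite !charge0_int subr0 add0r.
have m12 k : cintegral nu1 `[0, R0] (fun x => x%:C ^+ k) =
    cintegral nu2 `[0, R0] (fun x => x%:C ^+ k) by rewrite l1 l2.
have concRe (nu : cmeasure R R) : concentrated_on nu `[0, R0] -> forall A, measurable A ->
    A `&` `[0, R0]%classic = set0 -> cm_re nu A = 0%E.
  move=> c A mA /(c A mA) [h _].
  by rewrite -[LHS]fineK ?fin_num_measure// h.
have concIm (nu : cmeasure R R) : concentrated_on nu `[0, R0] -> forall A, measurable A ->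
    A `&` `[0, R0]%classic = set0 -> cm_im nu A = 0%E.
  move=> c A mA /(c A mA) [_ h].
  by rewrite -[LHS]fineK ?fin_num_measure// h.
move=> A mA; rewrite /cm_val.
rewrite (charge_moment_unique (concRe _ c1) (concRe _ c2) _ mA); last first.
  by move=> k; have := m12 k; rewrite !cE => -[].
rewrite (charge_moment_unique (concIm _ c1) (concIm _ c2) _ mA)//.
by move=> k; have := m12 k; rewrite !cE => -[].
Qed.

End moment_problem.

(** * Roots of unity and the star *)

Section roots_of_unity.
Variables (R : realType) (M : nat).
Hypothesis M_gt0 : (0 < M)%N.
Implicit Types (x y : R) (z lambda : R[i]).
Local Notation zeta := (zeta R M).
Local Notation rootM := (@rootM R M).

Lemma zeta_expE n :
  zeta ^+ n = cos (2 * pi / M%:R *+ n) +i* sin (2 * pi / M%:R *+ n).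
Proof.
elim: n => [|n IHn]; first by rewrite expr0 mulr0n cos0 sin0.
rewrite exprS IHn (mulrS (2 * pi / M%:R)) cosD sinD /Defs.zeta.
by apply: complex_eqP => //=; rewrite addrC.
Qed.

Lemma zeta_prim : M.-primitive_root zeta.
Proof.
have MR : (M%:R : R) != 0 by rewrite pnatr_eq0 -lt0n.
have zM : zeta ^+ M = 1.
  rewrite zeta_expE -mulr_natr divfK// mulr_natl cos2pi.
  by rewrite -[pi *+ 2]add0r sinD2pi sin0.
rewrite /primitive_root_of_unity M_gt0 /=; apply/forallP => i.
rewrite unity_rootE; apply/eqP; have [->|ne] := eqVneq i.+1 M; first by rewrite zM eqxx.
apply/negbTE/eqP => z1.
have iM : (i.+1 < M)%N by rewrite ltn_neqAle ne ltn_ord.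
(* A proper power of zeta equal to 1 would have cos (2 th) = 1 for some
   0 < th < pi, hence sin th = 0. *)
pose th : R := pi * i.+1%:R / M%:R.
have := congr1 (@complex.Re R) z1; rewrite zeta_expE /= (_ : _ *+ i.+1 = th *+ 2); last first.
  by rewrite /th -[LHS]mulr_natr -[RHS]mulr_natr; ring.
rewrite cos_mulr2n => c1.
have th0 : 0 < th by rewrite divr_gt0 ?mulr_gt0 ?pi_gt0 ?ltr0n.
have thpi : th < pi.
  by rewrite /th ltr_pdivrMr ?ltr0n// ltr_pM2l ?pi_gt0// ltr_nat.
have : 0 < sin th by apply: sin_gt0_pi; rewrite th0.
have /eqP : sin th ^+ 2 = 0 by rewrite sin2cos2; lra.
by rewrite sqrf_eq0 => /eqP ->; rewrite ltxx.
Qed.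

Lemma zetaM : zeta ^+ M = 1.
Proof. exact: prim_expr_order zeta_prim. Qed.

Lemma zeta_neq0 : zeta != 0.
Proof.
apply/eqP => z0; have := zetaM; rewrite z0 expr0n gtn_eqF// => /esym/eqP.
by rewrite oner_eq0.
Qed.

Lemma normc_zetaX r : Normc.normc (zeta ^+ r) = 1.
Proof. by rewrite zeta_expE /= cos2Dsin2 sqrtr1. Qed.

(** Orthogonality of the characters of the cyclic group of order [M]; [w] below is the
    ratio of the geometric progression. *)
Lemma sum_zeta n s :
  \sum_(r < M) zeta ^- (r * s) * zeta ^+ (r * n) =
  if (n == s %[mod M])%N then M%:R else 0.
Proof.
pose w := zeta ^- s * zeta ^+ n.
have zs0 k : zeta ^+ k != 0 by rewrite expf_neq0// zeta_neq0.
have -> : \sum_(r < M) zeta ^- (r * s) * zeta ^+ (r * n) = \sum_(r < M) w ^+ r.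
  apply: eq_bigr => r _; rewrite /w exprMn exprVn -!exprM mulnC.
  by rewrite [(n * r)%N]mulnC.
have -> : (n == s %[mod M])%N = (w == 1).
  rewrite -(eq_prim_root_expr zeta_prim) /w -[RHS](inj_eq (mulfI (zs0 s))).
  by rewrite mulVKf// mulr1.
case: ifPn => [/eqP ->|w1].
  by under eq_bigr do rewrite expr1n; rewrite sumr_const card_ord.
have wM : w ^+ M = 1.
  by rewrite /w exprMn exprVn -!exprM ![(_ * M)%N]mulnC !exprM zetaM !expr1n invr1 mulr1.
have /eqP := subrX1 w M; rewrite wM subrr eq_sym mulf_eq0 subr_eq0 (negbTE w1)/=.
by move/eqP.
Qed.

Lemma rootM_ge0 x : 0 <= rootM x.
Proof. exact: powR_ge0. Qed.

Lemma rootMX x : 0 <= x -> rootM x ^+ M = x.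
Proof.
move=> x0; rewrite /Defs.rootM -powR_mulrn ?powR_ge0// -powRrM mulVf ?powRr1//.
by rewrite pnatr_eq0 -lt0n.
Qed.

Lemma rootM_le x y : 0 <= x -> x <= y -> rootM x <= rootM y.
Proof. by move=> x0 xy; rewrite ge0_ler_powR ?nnegrE ?invr_ge0// (le_trans x0). Qed.

(** The star is the preimage of [0, R0] under the M-th power, since two M-th roots of
    the same nonzero number differ by a power of the primitive root zeta. *)
Lemma starP R0 z : 0 <= R0 -> star M R0 z <-> exists2 x, 0 <= x <= R0 & z ^+ M = x%:C.
Proof.
move=> R00; split.
  move=> [r rM [t /andP[t0 tR] ->]]; exists (t ^+ M).
    by rewrite exprn_ge0//= -(rootMX R00) lerXn2r// nnegrE rootM_ge0.
  by rewrite exprMn -exprM mulnC exprM zetaM expr1n mul1r rmorphXn.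
move=> [x /andP[x0 xR] zx]; have [xz|xn0] := eqVneq x 0.
  exists 0%N => //; exists 0; first by rewrite lexx rootM_ge0.
  by move: zx => /eqP; rewrite xz mulr0 expf_eq0 M_gt0 /= => /eqP.
have tX : (rootM x)%:C ^+ M = x%:C by rewrite -rmorphXn /= rootMX.
have t0 : (rootM x)%:C != 0.
  by apply: contra_neq xn0 => t0; move: tX; rewrite t0 expr0n gtn_eqF// => -[].
have /(prim_rootP zeta_prim)[r zr] : (z / (rootM x)%:C) ^+ M = 1.
  by rewrite expr_div_n zx tX divff// -tX expf_neq0.
exists r => //; exists (rootM x); first by rewrite rootM_ge0 rootM_le.
by rewrite -zr divfK.
Qed.

Lemma normcX (z : R[i]) n : Normc.normc (z ^+ n) = Normc.normc z ^+ n.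
Proof. by elim: n => [|n IHn]; rewrite ?expr0 ?Normc.normc1// !exprS Normc.normcM IHn. Qed.

Lemma normc_real (x : R) : 0 <= x -> Normc.normc x%:C = x.
Proof. by move=> x0; rewrite /= expr0n addr0 sqrtr_sqr ger0_norm. Qed.

Lemma star_normc R0 z : 0 <= R0 -> star M R0 z ->
  Normc.normc z <= rootM R0 /\ z ^+ M = (Normc.normc z ^+ M)%:C.
Proof.
move=> R00 [r rM [t /andP[t0 tR] ->]].
rewrite Normc.normcM normc_zetaX mul1r normc_real//; split => //.
by rewrite exprMn -exprM mulnC exprM zetaM expr1n mul1r rmorphXn.
Qed.

Lemma star_normcX R0 z n : 0 <= R0 -> star M R0 z ->
  Normc.normc (z ^+ n) <= rootM R0 ^+ n.
Proof.
move=> R00 Sz; rewrite normcX lerXn2r ?nnegrE ?normc_ge0 ?rootM_ge0//.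
by have [] := star_normc R00 Sz.
Qed.

Lemma star_root R0 r x : 0 <= x <= R0 -> star M R0 (zeta ^+ r * (rootM x)%:C).
Proof.
move=> /andP[x0 xR]; apply/starP; first exact: le_trans xR.
exists x; first by rewrite x0.
by rewrite exprMn -exprM mulnC exprM zetaM expr1n mul1r -rmorphXn /= rootMX.
Qed.

Lemma measurable_star R0 : 0 <= R0 -> measurable (star M R0 : set R[i]).
Proof.
move=> R00; have mX : measurable_fun setT (fun z : R[i] => z ^+ M).
  by apply: measurable_cplxX; exact: measurable_id.
rewrite (_ : star M R0 = ((fun z => complex.Re (z ^+ M)) @^-1` `[0, R0]) `&`
    ((fun z => complex.Im (z ^+ M)) @^-1` [set 0])); last first.
  apply/seteqP; split => z /=.
    by move=> /(starP _ R00)[x x0R ->] /=; rewrite in_itv.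
  rewrite in_itv/= => -[xR z0]; apply/starP => //.
  exists (complex.Re (z ^+ M)) => //; exact: complex_eqP.
have [mre mim] := (measurable_complexP _).1 mX.
by apply: measurableI; rewrite -[X in measurable X]setTI; [exact: mre|exact: mim].
Qed.

(** The M-th power of [lambda] is outside the segment [0, R0]; its distance to the
    segment is bounded below by |Im|, or, on the real line, by the distance to the
    nearest endpoint. *)
Lemma not_star_dist R0 lambda : 0 <= R0 -> ~ star M R0 lambda ->
  exists2 e, 0 < e & forall x, 0 <= x <= R0 ->
    e <= Normc.normc (lambda ^+ M - x%:C).
Proof.
move=> R00 nl; set w := lambda ^+ M.
have [im0|im0] := eqVneq (complex.Im w) 0; last first.
  exists `|complex.Im w| => [|x _]; first by rewrite normr_gt0.
  by apply: le_trans (normIm_le_normc _); case: (w) => ? ? /=; rewrite oppr0 addr0.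
have wE : w = (complex.Re w)%:C by apply: complex_eqP.
have ReB x : complex.Re (w - x%:C) = complex.Re w - x by case: (w).
have [w0|w0] := ltP (complex.Re w) 0.
  exists (- complex.Re w) => [|x /andP[x0 xR]]; first by rewrite oppr_gt0.
  by apply: le_trans (normRe_le_normc _); rewrite ReB ler_normr; lra.
have [wR|wR] := ltP R0 (complex.Re w).
  exists (complex.Re w - R0) => [|x /andP[x0 xR]]; first by rewrite subr_gt0.
  by apply: le_trans (normRe_le_normc _); rewrite ReB ler_normr; lra.
by case: nl; apply/starP => //; exists (complex.Re w); rewrite ?w0.
Qed.

Lemma normc_sum I (r : seq I) (F : I -> R[i]) :
  Normc.normc (\sum_(i <- r) F i) <= \sum_(i <- r) Normc.normc (F i).
Proof.
elim: r => [|i r IHr]; first by rewrite !big_nil Normc.normc0.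
by rewrite !big_cons (le_trans (le_normcD _ _))// lerD2l.
Qed.

(** Factor lambda^M - z^M by lambda - z. *)
Lemma resolventE R0 lambda z : 0 <= R0 -> ~ star M R0 lambda -> star M R0 z ->
  (lambda - z)^-1 = (lambda ^+ M - z ^+ M)^-1 *
    \sum_(i < M) lambda ^+ (M.-1 - i) * z ^+ i.
Proof.
move=> R00 nl sz; have [e e0 eP] := not_star_dist R00 nl.
have [x x0R zx] := (starP z R00).1 sz.
have d0 : lambda ^+ M - z ^+ M != 0.
  by apply/eqP => d0; have := eP x x0R; rewrite -zx d0 Normc.normc0 leNgt e0.
have dE : lambda ^+ M - z ^+ M =
    (lambda - z) * \sum_(i < M) lambda ^+ (M.-1 - i) * z ^+ i by exact: subrXX.
have l0 : lambda - z != 0 by apply: contra_neq d0 => l0; rewrite dE l0 mul0r.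
by apply: (mulfI l0); rewrite divff// mulrCA -dE mulVf.
Qed.

Lemma resolvent_bounded R0 lambda : 0 <= R0 -> ~ star M R0 lambda ->
  exists K, forall z, star M R0 z -> Normc.normc (lambda - z)^-1 <= K.
Proof.
move=> R00 nl; have [e e0 eP] := not_star_dist R00 nl.
exists (e^-1 * \sum_(i < M) Normc.normc lambda ^+ (M.-1 - i) * rootM R0 ^+ i) => z sz.
rewrite (resolventE R00 nl sz) Normc.normcM Normc.normcV.
have [x x0R zx] := (starP z R00).1 sz.
apply: ler_pM; rewrite ?invr_ge0 ?normc_ge0//.
  rewrite lef_pV2 ?posrE//; rewrite zx; first exact: eP.
  exact: lt_le_trans e0 (eP _ x0R).
apply: le_trans (normc_sum _ _) _; apply: ler_sum => i _.
rewrite Normc.normcM !normcX ler_wpM2l ?exprn_ge0 ?normc_ge0//.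
by rewrite lerXn2r ?nnegrE ?normc_ge0 ?rootM_ge0//; have [] := star_normc R00 sz.
Qed.

(** In the expansion [resolventE], summation over the rays keeps only the power
    of exponent [s], by orthogonality. *)
Lemma resolvent_sum R0 lambda s x : 0 <= R0 -> ~ star M R0 lambda ->
  (s < M)%N -> 0 <= x <= R0 ->
  \sum_(r < M) zeta ^- (r * s) * (lambda - zeta ^+ r * (rootM x)%:C)^-1 =
  M%:R * (lambda ^+ (M - s - 1) * (rootM x)%:C ^+ s * (lambda ^+ M - x%:C)^-1).
Proof.
move=> R00 nl sM x0R; set t := (rootM x)%:C.
have tX : t ^+ M = x%:C by rewrite /t -rmorphXn /= rootMX//; case/andP: x0R.
have rE (r : 'I_M) : zeta ^- (r * s) * (lambda - zeta ^+ r * t)^-1 =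
    \sum_(i < M) (lambda ^+ M - x%:C)^-1 * lambda ^+ (M.-1 - i) * t ^+ i *
      (zeta ^- (r * s) * zeta ^+ (r * i)).
  rewrite (resolventE R00 nl (star_root r x0R)).
  have -> : (zeta ^+ r * t) ^+ M = x%:C.
    by rewrite exprMn -exprM mulnC exprM zetaM expr1n mul1r.
  rewrite mulrCA !mulr_sumr.
  by apply: eq_bigr => i _; rewrite exprMn -exprM; ring.
under eq_bigr do rewrite rE.
rewrite exchange_big /=.
under eq_bigr => i _ do rewrite -mulr_sumr sum_zeta.
rewrite (bigD1 (Ordinal sM))//= eqxx big1 ?addr0; last first.
  move=> i /negPf is_; rewrite !modn_small//; case: eqP => [e|_]; last by rewrite mulr0.
  by move: is_ => /eqP; case; exact/val_inj.
rewrite (_ : (M - s - 1 = M.-1 - s)%N); first by ring.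
by rewrite -subnDA addn1 -subn1 -subnDA add1n.
Qed.

Lemma weight_root s x : (s = 0)%N \/ 0 < x -> rootM x ^+ s * weight M s x = 1.
Proof.
move=> [->|x0]; first by rewrite expr0 mul1r /weight mul0r oppr0 powRr0.
rewrite /Defs.rootM /weight -powR_mulrn ?powR_ge0// -powRrM powRN mulrC.
by rewrite [M%:R^-1 * _]mulrC mulVf// gt_eqF// powR_gt0.
Qed.

End roots_of_unity.

(** * Periodicity of the recurrence matrix *)

Lemma moment_functionalXn (C : nzRingType) (m : nat -> C) n :
  moment_functional m 'X^n = m n.
Proof.
rewrite /moment_functional size_polyXn big_ord_recr /= coefXn eqxx mul1r.
rewrite big1 ?add0r// => i _; rewrite coefXn.
by rewrite ltn_eqF// mul0r.
Qed.

Section periodicity.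
Variables (R : realType) (p q : nat).
Local Open Scope nat_scope.
Hypothesis p_gt0 : 0 < p.

Lemma nth_state_label k : 0 < (nth_state p q k).2 <= p + q.
Proof.
rewrite /nth_state; set s := states_below _ _ _.
have [ks|ks] := ltnP k (size s); last by rewrite nth_default//= addn_gt0 p_gt0.
by have := mem_nth (0, 1) ks; rewrite mem_filter => /andP[/and3P[]].
Qed.

Lemma next_pos_mod j : 0 < j <= p + q -> next_pos p q j = j.+1 %[mod p + q].
Proof.
rewrite /next_pos => /andP[j0 jM]; case: ltnP => // Mj.
have -> : j = p + q by lia.
by rewrite -[(p + q).+1]addn1 modnDl.
Qed.

(** Every nonzero entry of the matrix leads from a label to the next one in cyclic
    order, so a nonzero entry of its n-th power advances the label by [n]. *)
Lemma imx_pow_label (tF : seq (factor R)) n x y : 0 < x.2 <= p + q ->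
  imx_pow (Hmx p q tF) n x y != 0%R -> y.2 = x.2 + n %[mod p + q].
Proof.
elim: n x => [|n IHn] x xM.
  rewrite /imx_pow/= /imx_one; have [->|_] := eqVneq x y; first by rewrite addn0.
  by rewrite eqxx.
rewrite [imx_pow _ _]/(imx_mul _ _) /imx_mul => nz.
have [z Hz pz] : exists2 z, Hmx p q tF x z != 0%R & imx_pow (Hmx p q tF) n z y != 0%R.
  apply: contrapT => noz; move/eqP: nz; apply; apply: fsbig1 => z _.
  have [->|H0] := eqVneq (Hmx p q tF x z) 0%R; first by rewrite mul0r.
  have [e|P0] := eqVneq (imx_pow (Hmx p q tF) n z y) 0%R.
    by rewrite [X in (_ * X)%R]e mulr0.
  by case: noz; exists z.
move: Hz; rewrite /Hmx; case: ifP; last by rewrite eqxx.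
move=> /and3P[_ /and3P[z0 _ _] /eqP zE] _.
by rewrite (IHn z z0 pz) -modnDml zE next_pos_mod// modnDml addSnnS.
Qed.

Lemma Hpow_eq0 (tF : seq (factor R)) j i n :
  n <> shift p q j i %[mod p + q] -> Hpow p q tF j i n = 0%R.
Proof.
move=> ns; rewrite /Hpow; set h := imx_pow _ _ _ _.
have [->//|h0] := eqVneq h 0%R; case: ns.
have := imx_pow_label (nth_state_label j) h0.
have /andP[b0 bM] := nth_state_label j.
rewrite /shift modn_mod => E.
rewrite -modnDml E modnDml.
set b := (nth_state p q j).2.
by rewrite (_ : b + n + (p + q - b) = n + (p + q)) ?modnDr//; rewrite /b; lia.
Qed.

Lemma shift_lt j i : shift p q j i < p + q.
Proof. by rewrite ltn_mod addn_gt0 p_gt0. Qed.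

End periodicity.

(** * Necessity of the radial condition *)

Section restrict0.
Context d (T : measurableType d) (R : realType).
Implicit Types (D E : set T) (f : T -> R[i]).

Definition restrict0 D f := fun x => if x \in D then f x else 0.

Variable m : {measure set T -> \bar R}.

Lemma cintegrable_restrict0 D f : measurable D -> cintegrable m D f ->
  cintegrable m setT (restrict0 D f).
Proof.
move=> mD [ir ii]; split.
  move: ir; rewrite integrable_mkcond//; apply: eq_integrable => // x _.
  by rewrite patchE /restrict0; case: ifP.
move: ii; rewrite integrable_mkcond//; apply: eq_integrable => // x _.
by rewrite patchE /restrict0; case: ifP.
Qed.

Lemma cint_restrict0 D E f : cint m E (restrict0 D f) = cint m (D `&` E) f.
Proof.
rewrite /cint; congr Complex; rewrite Rintegral_mkcondl.
  by apply: eq_Rintegral => x _; rewrite patchE /restrict0; case: ifP.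
by apply: eq_Rintegral => x _; rewrite patchE /restrict0; case: ifP.
Qed.

End restrict0.

Section single_density.
Context d d' (T : measurableType d) (T' : measurableType d') (R : realType).
Variables (m : {finite_measure set T' -> \bar R}) (phi : T' -> T) (g : T' -> R[i]).
Hypothesis mphi : measurable_fun setT phi.
Hypothesis ig : cintegrable m setT g.

Lemma cintegral_density (nu : cmeasure T R) D (f : T -> R[i]) :
  (forall A, measurable A -> cm_val nu A = cint m (phi @^-1` A) g) ->
  measurable D -> measurable_fun setT f ->
  cintegrable m (phi @^-1` D) (fun x => f (phi x) * g x) ->
  cintegral nu D f = cint m (phi @^-1` D) (fun x => f (phi x) * g x).
Proof.
move=> nuE mD mf ifg.
rewrite (@cintegral_density_sum _ _ _ _ _ m unit [:: tt] (fun=> phi) (fun=> g))//.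
  by rewrite big_seq1.
by move=> A mA; rewrite big_seq1 nuE.
Qed.

Lemma cmeasure_of_density : exists nu : cmeasure T R, forall A, measurable A ->
  cm_val nu A = cint m (phi @^-1` A) g.
Proof.
have [nu nuE] := @cmeasure_density_sum _ T R _ _ m unit [:: tt] (fun=> phi) (fun=> g)
  (fun=> mphi) (fun=> ig).
by exists nu => A mA; rewrite nuE// big_seq1.
Qed.

End single_density.

Lemma bounded_cintegrable d (T : measurableType d) (R : realType)
    (m : {measure set T -> \bar R}) D (f g : T -> R[i]) K :
  measurable D -> measurable_fun setT f -> measurable_fun setT g ->
  (forall x, D x -> Normc.normc (f x) <= K) ->
  cintegrable m D g -> cintegrable m D (fun x => f x * g x).
Proof.
move=> mD mf mg fK ig.
apply: (@le_cintegrable _ _ _ _ _ _ (fun x => K * Normc.normc (g x))) => //.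
- exact: measurable_cplxM.
- by move=> x Dx; rewrite Normc.normcM ler_wpM2r ?normc_ge0 ?fK.
- exact: integrableZl (integrable_normc mD mg ig).
Qed.

Section necessity.
Variables (R : realType) (M s : nat) (R0 : R).
Hypotheses (M_gt0 : (0 < M)%N) (R0_ge0 : 0 <= R0).
Variables (rho : cmeasure R R) (nu : cmeasure R[i] R).
Variables (Lambda Psi : {poly R[i]} -> R[i]).
Hypothesis rhoL : represents (fun x : R => x%:C) rho `[0, R0] Lambda.
Hypothesis nuP : represents id nu (star M R0) Psi.
Hypothesis PsiE : forall k, Psi 'X^(s + M * k) = Lambda 'X^k.

Let S := star M R0 : set R[i].
Let phi (z : R[i]) := complex.Re (z ^+ M).

Let mS : measurable S. Proof. exact: measurable_star. Qed.

Let mphi : measurable_fun setT phi.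
Proof.
have mX : measurable_fun setT (fun z : R[i] => z ^+ M).
  by apply: measurable_cplxX; exact: measurable_id.
exact: ((measurable_complexP _).1 mX).1.
Qed.

Let phiS z : S z -> 0 <= phi z <= R0 /\ z ^+ M = (phi z)%:C.
Proof. by move=> /(starP M_gt0 _ R0_ge0)[x x0R zx]; rewrite /phi zx. Qed.

Let rootM_phi z : S z -> rootM M (phi z) = Normc.normc z.
Proof.
move=> Sz; have [/andP[p0 _] zM] := phiS Sz; have [_ zn] := star_normc M_gt0 R0_ge0 Sz.
apply: (@pexpIrn _ _ M_gt0); rewrite ?nnegrE ?rootM_ge0 ?normc_ge0//.
by rewrite rootMX//; move: zM; rewrite zn => -[].
Qed.

(** The image [kappa] under the M-th power of the measure z^s dnu is concentrated on
    [0, R0] and has the same moments as [rho]: they are the moments of order s + Mk of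
    [nu]. By determinacy of the moment problem on a bounded interval it is [rho]. *)
Lemma radial_density : exists (m : {finite_measure set R[i] -> \bar R}) h,
  cintegrable m setT h /\
  forall A, measurable A ->
    cm_val rho A = cint m (phi @^-1` A) (restrict0 S (fun z => z ^+ s * h z)).
Proof.
have [m [h [ih nuE]]] := cmeasure_density nu.
have mh := cintegrable_measurable ih.
have [nuS nuX] := nuP.
have mX n : measurable_fun setT (fun z : R[i] => z ^+ n).
  by apply: measurable_cplxX; exact: measurable_id.
have ihS : cintegrable m S h by apply: cintegrableS ih.
have boundX n z : S z -> Normc.normc (z ^+ n) <= rootM M R0 ^+ n.
  exact: star_normcX.
have iXh n : cintegrable m S (fun z => z ^+ n * h z).
  by apply: bounded_cintegrable ihS => //; exact: boundX.
pose g := restrict0 S (fun z => z ^+ s * h z).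
have ig : cintegrable m setT g by exact: cintegrable_restrict0.
have mg := cintegrable_measurable ig.
have [kappa kE] := cmeasure_of_density mphi ig.
exists m, h; split => // A mA; rewrite -kE//.
apply: (cmeasure_moment_unique R0_ge0 rhoL _ mA) => {A mA}; split.
  move=> A mA A0; rewrite kE// -(cint0 m (phi @^-1` A)); apply: eq_cint => z.
  rewrite inE /g /restrict0 /= => Az; case: ifPn => //; rewrite inE => /phiS[pz _].
  suff : (A `&` `[0, R0]) (phi z) by rewrite A0.
  by split => //=; rewrite in_itv.
move=> k; have mD : measurable (`[0, R0]%classic : set R) by exact: measurable_itv.
have mpD := measurable_preimage mphi mD.
have SE : S = S `&` phi @^-1` `[0, R0]%classic.
  apply/seteqP; split => z; last by case.
  by move=> Sz; split => //=; rewrite in_itv/=; have [] := phiS Sz.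
have gE : (fun z => (phi z)%:C ^+ k * g z) =1 restrict0 S (fun z => z ^+ (s + M * k) * h z).
  move=> z; rewrite /g /restrict0; case: ifPn; last by rewrite mulr0.
  by rewrite inE => /phiS[_ zM]; rewrite exprD exprM zM; ring.
have mRX : measurable_fun setT (fun x : R => x%:C ^+ k).
  by apply: measurable_cplxX; exact: measurable_real_complex.
rewrite (cintegral_density mphi ig kE mD mRX); last first.
  apply: (@eq_cintegrable _ _ _ _ _ (restrict0 S (fun z => z ^+ (s + M * k) * h z))) => //.
  exact: (cintegrableS measurableT mpD (@subsetT _ _) (cintegrable_restrict0 mS (iXh _))).
rewrite (@eq_cint _ _ _ m _ _ (restrict0 S (fun z => z ^+ (s + M * k) * h z))); last first.
  by move=> z _; rewrite gE.
rewrite cint_restrict0 -SE -PsiE -nuX.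
by rewrite (cintegral_density (phi := id) _ ih).
Qed.

(** For s > 0 the factor z^s in the density of [rho] vanishes over the origin, and its
    modulus compensates the weight elsewhere. *)
Lemma radial_condition_necessary : radial_condition M s R0 rho.
Proof.
move=> s_gt0; have [m [h [ih rhoE]]] := radial_density.
have mh := cintegrable_measurable ih.
have mX n : measurable_fun setT (fun z : R[i] => z ^+ n).
  by apply: measurable_cplxX; exact: measurable_id.
have boundX n z : S z -> Normc.normc (z ^+ n) <= rootM M R0 ^+ n.
  exact: star_normcX.
have ig : cintegrable m setT (restrict0 S (fun z => z ^+ s * h z)).
  apply: cintegrable_restrict0 => //.
  apply: (@bounded_cintegrable _ _ _ _ _ _ _ (rootM M R0 ^+ s)) => //.
    exact: boundX.
  exact: cintegrableS ih.
have mg := cintegrable_measurable ig.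
have mw : measurable_fun setT (weight M s : R -> R) by exact: measurable_powR.
have w0 x : 0 <= weight M s x :> R by exact: powR_ge0.
split.
  rewrite rhoE// -(cint0 m (phi @^-1` [set 0])); apply: eq_cint => z.
  rewrite inE /= /restrict0 => pz; case: ifPn => //; rewrite inE => /phiS[_].
  rewrite pz => /eqP; rewrite expf_eq0 M_gt0 /= => /eqP ->.
  by rewrite expr0n gtn_eqF// mul0r.
have mD : measurable (`]0, R0]%classic : set R) by exact: measurable_itv.
have mpD := measurable_preimage mphi mD.
apply: (total_variation_weight_lty mw w0 mD mphi ig rhoE).
have ihn : m.-integrable (phi @^-1` `]0, R0]) (fun z => (Normc.normc (h z))%:E).
  by apply: integrable_normc => //; exact: cintegrableS ih.
apply: le_integrable ihn => //.
  apply/measurable_EFinP/measurable_funTS; apply: measurable_funM.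
    exact: measurableT_comp mw mphi.
  exact: measurable_normc.
move=> z /=; rewrite in_itv/= => /andP[p0 pR]; rewrite lee_fin.
rewrite !ger0_norm ?mulr_ge0 ?normc_ge0// /restrict0.
case: ifPn; last by rewrite Normc.normc0 mulr0 normc_ge0.
rewrite inE => Sz; rewrite Normc.normcM normcX -(rootM_phi Sz) mulrA mulrAC.
by rewrite mulrAC [weight _ _ _ * _]mulrC weight_root ?mul1r//; right.
Qed.

End necessity.

(** * Construction of the lift *)

Section sufficiency.
Variables (R : realType) (M s : nat) (R0 : R).
Hypotheses (M_gt0 : (0 < M)%N) (R0_ge0 : 0 <= R0).
Variable rho : cmeasure R R.
Hypothesis rho_cond : radial_condition M s R0 rho.

Local Notation zeta := (zeta R M).
Local Notation S := (star M R0 : set R[i]).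
Local Notation dom := (radial_dom s R0).
Local Notation w := (@weight R M s).
Let ray (r : nat) (x : R) : R[i] := zeta ^+ r * (rootM M x)%:C.

Let mS : measurable S. Proof. exact: measurable_star. Qed.

Let mdom : measurable dom.
Proof. by rewrite /radial_dom; case: ifP => _; exact: measurable_itv. Qed.

Let mw : measurable_fun setT w. Proof. exact: measurable_powR. Qed.

Let mray r : measurable_fun setT (ray r).
Proof.
apply: measurable_cplxM; first exact: measurable_cst.
apply: measurableT_comp; first exact: measurable_real_complex.
exact: measurable_powR.
Qed.

Lemma radial_dom_itv x : dom x -> 0 <= x <= R0 /\ ((s = 0)%N \/ 0 < x).
Proof.
rewrite /radial_dom; case: ifPn => [/eqP -> | _]; rewrite /= in_itv/= => /andP[x0 ->].
  by rewrite x0; split => //; left.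
by rewrite ltW//; split => //; right.
Qed.

Let rayS r x : dom x -> S (ray r x).
Proof. by move=> /radial_dom_itv[x0R _]; exact: star_root. Qed.

Let weighted (m : {finite_measure set R -> \bar R}) h : cintegrable m setT h ->
  (forall A, measurable A -> cm_val rho A = cint m A h) ->
  cintegrable m dom (fun x => (w x)%:C * h x).
Proof.
move=> ih rhoE; have [s0|s0] := posnP s.
  apply: (@eq_cintegrable _ _ _ _ _ h) => //.
    by move=> x _; rewrite /weight s0 mul0r oppr0 powRr0 mul1r.
  exact: cintegrableS ih.
have w0 x : 0 <= w x by exact: powR_ge0.
apply: (weighted_cintegrable mw w0 mdom ih rhoE).
by have [_] := rho_cond s0; rewrite /radial_dom gtn_eqF.
Qed.

(** The lift is the sum of the images of x^(-s/M) drho under the parametrizations of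
    the M rays, with the coefficients zeta^(-rs) / M; the radial condition says that
    x^(-s/M) drho is a finite complex measure. *)
Lemma lift_exists : exists rhohat : cmeasure R[i] R,
  concentrated_on rhohat S /\
  forall f : R[i] -> R[i], measurable_fun setT f ->
    (exists K, forall z, S z -> Normc.normc (f z) <= K) ->
    cintegral rhohat S f = M%:R^-1 * \sum_(r < M) (zeta ^- (r * s) *
      cintegral rho dom (fun x => f (ray r x) * (w x)%:C)).
Proof.
have [m [h [ih rhoE]]] := cmeasure_density rho.
have mh := cintegrable_measurable ih.
have iwh := weighted ih rhoE.
have mwC : measurable_fun setT (fun x => (w x)%:C : R[i]).
  by apply: measurableT_comp mw; exact: measurable_real_complex.
have mwh : measurable_fun setT (fun x => (w x)%:C * h x) by exact: measurable_cplxM.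
pose c r : R[i] := M%:R^-1 * zeta ^- (r * s).
pose g (r : 'I_M) := restrict0 dom (fun x => c r * ((w x)%:C * h x)).
have ig r : cintegrable m setT (g r).
  by apply: cintegrable_restrict0 => //; exact: cintegrableZ.
have [nu nuE] := @cmeasure_density_sum _ _ R _ _ m 'I_M (index_enum 'I_M)
  (fun r => ray r) g (fun r => mray r) ig.
exists nu; split.
  move=> A mA A0; rewrite nuE// big1// => r _.
  rewrite -(cint0 m (ray r @^-1` A)); apply: eq_cint => x; rewrite inE /= => Ax.
  rewrite /g /restrict0; case: ifPn => //; rewrite inE => /(rayS r) Sx.
  by have : (A `&` S) (ray r x) by []; rewrite A0.
move=> f mf [K fK].
have mfr r : measurable_fun setT (fun x => f (ray r x)) by exact: measurableT_comp mf (mray r).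
have ifw r : cintegrable m dom (fun x => f (ray r x) * ((w x)%:C * h x)).
  by apply: bounded_cintegrable iwh => // x /(rayS r); exact: fK.
have gE (r : 'I_M) x : f (ray r x) * g r x =
    restrict0 dom (fun x => c r * (f (ray r x) * ((w x)%:C * h x))) x.
  by rewrite /g /restrict0; case: ifP => _; rewrite ?mulr0// mulrCA.
have ifg r : cintegrable m setT
    (restrict0 dom (fun x => c r * (f (ray r x) * ((w x)%:C * h x)))).
  by apply: cintegrable_restrict0 => //; exact: cintegrableZ.
rewrite (cintegral_density_sum (fun r : 'I_M => mray r) ig nuE mS mf); last first.
  move=> r; have mpS := measurable_preimage (mray r) mS.
  apply: eq_cintegrable (cintegrableS measurableT mpS (@subsetT _ _) (ifg r)) => //.
rewrite mulr_sumr; apply: eq_bigr => r _.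
rewrite (@eq_cint _ _ _ m _ _ (restrict0 dom
  (fun x => c r * (f (ray r x) * ((w x)%:C * h x))))); last first.
  by move=> x _; rewrite gE.
rewrite cint_restrict0 setIidl; last by move=> x /(rayS r).
rewrite cintZ// /c -mulrA; congr (_ * (_ * _)).
rewrite (@cintegral_density _ _ _ _ _ m id h (@measurable_id _ _ _) ih rho dom)//.
- by apply: eq_cint => x _; rewrite mulrA.
- exact: measurable_cplxM.
- by apply: eq_cintegrable (ifw r) => // x _; rewrite mulrA.
Qed.

(** The function whose integral defines the lift is moved inside a single integral
    against [rho], where the sum over the rays can be computed pointwise and the weight
    cancels the s-th power of the root. The origin may then be added to the domain,
    since it has no mass when s > 0. *)
Lemma lift_value (f : R[i] -> R[i]) (G : R -> R[i]) K K' :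
  measurable_fun setT f -> (forall z, S z -> Normc.normc (f z) <= K) ->
  measurable_fun setT G -> (forall x, 0 <= x <= R0 -> Normc.normc (G x) <= K') ->
  (forall x, dom x -> \sum_(r < M) zeta ^- (r * s) * f (ray r x) =
    M%:R * ((rootM M x)%:C ^+ s * G x)) ->
  M%:R^-1 * \sum_(r < M) (zeta ^- (r * s) *
      cintegral rho dom (fun x => f (ray r x) * (w x)%:C)) =
  cintegral rho `[0, R0] G.
Proof.
move=> mf fK mG GK fG.
have [m [h [ih rhoE]]] := cmeasure_density rho.
have mh := cintegrable_measurable ih.
have iwh := weighted ih rhoE.
have mwC : measurable_fun setT (fun x => (w x)%:C : R[i]).
  by apply: measurableT_comp mw; exact: measurable_real_complex.
have mwh : measurable_fun setT (fun x => (w x)%:C * h x) by exact: measurable_cplxM.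
have mfr r : measurable_fun setT (fun x => f (ray r x)) by exact: measurableT_comp mf (mray r).
have ifw r : cintegrable m dom (fun x => f (ray r x) * ((w x)%:C * h x)).
  by apply: bounded_cintegrable iwh => // x /(rayS r); exact: fK.
have rE r : zeta ^- (r * s) * cintegral rho dom (fun x => f (ray r x) * (w x)%:C) =
    cint m dom (fun x => zeta ^- (r * s) * (f (ray r x) * ((w x)%:C * h x))).
  rewrite cintZ//; congr (_ * _).
  rewrite (@cintegral_density _ _ _ _ _ m id h (@measurable_id _ _ _) ih rho dom)//.
  - by apply: eq_cint => x _; rewrite mulrA.
  - exact: measurable_cplxM.
  - by apply: eq_cintegrable (ifw r) => // x _; rewrite mulrA.
under eq_bigr do rewrite rE.
have [_ <-] := @cint_sum _ _ _ m 'I_M (index_enum 'I_M) dom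
  (fun r x => zeta ^- (r * s) * (f (ray r x) * ((w x)%:C * h x))) mdom
  (fun r => cintegrableZ (zeta ^- (r * s)) mdom (ifw r)).
have mD : measurable (`[0, R0]%classic : set R) by exact: measurable_itv.
have domD : dom `<=` `[0, R0]%classic.
  by move=> x /radial_dom_itv[x0R _]; rewrite /= in_itv.
have iGh : cintegrable m `[0, R0] (fun x => G x * h x).
  apply: (@bounded_cintegrable _ _ _ _ _ _ _ K') => //.
  exact: cintegrableS ih.
rewrite (@cintegral_density _ _ _ _ _ m id h (@measurable_id _ _ _) ih rho `[0, R0]%classic)//.
have M0 : (M%:R : R[i]) != 0 by rewrite pnatr_eq0 -lt0n.
have -> : cint m dom (fun x => \sum_(r < M) zeta ^- (r * s) * (f (ray r x) * ((w x)%:C * h x)))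
    = M%:R * cint m dom (fun x => G x * h x).
  rewrite -cintZ//; last exact: cintegrableS iGh.
  apply: eq_cint => x; rewrite inE => dx.
  have -> : \sum_(r < M) zeta ^- (r * s) * (f (ray r x) * ((w x)%:C * h x)) =
      (\sum_(r < M) zeta ^- (r * s) * f (ray r x)) * ((w x)%:C * h x).
    by rewrite mulr_suml; apply: eq_bigr => r _; rewrite !mulrA.
  rewrite fG// -!mulrA; congr (_ * _).
  have [_ x0] := radial_dom_itv dx.
  have := congr1 (fun y : R => y%:C : R[i]) (@weight_root R M s x x0).
  rewrite rmorphM rmorphXn /= => wx.
  have -> : (rootM M x)%:C ^+ s * (G x * ((w x)%:C * h x)) =
      (rootM M x)%:C ^+ s * (w x)%:C * (G x * h x) by ring.
  by rewrite wx mul1r.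
rewrite mulKf//; rewrite {1}/radial_dom; case: ifPn => // s0.
have s_gt0 : (0 < s)%N by rewrite lt0n.
have [rho0 _] := rho_cond s_gt0.
have mI : measurable (`]0, R0]%classic : set R) by exact: measurable_itv.
have m0 : measurable ([set 0] : set R) by exact: measurable_set1.
(* The integral over [0, R0] splits at the origin. *)
pose G1 := restrict0 (`]0, R0]%classic : set R) (fun x => G x * h x).
pose G0 := restrict0 ([set 0] : set R) (fun x => G 0 * h x).
have i0 : cintegrable m setT G0.
  by apply: cintegrable_restrict0 => //; apply: cintegrableZ => //; exact: cintegrableS ih.
have i1 : cintegrable m setT G1.
  apply: cintegrable_restrict0 => //; apply: cintegrableS iGh => // x /=.
  by rewrite !in_itv/= => /andP[/ltW -> ->].
rewrite [RHS](@eq_cint _ _ _ m _ (fun x => G x * h x) (fun x => G0 x + G1 x)); last first.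
  move=> x; rewrite inE /= in_itv/= => /andP[x0 xR]; rewrite /G0 /G1 /restrict0.
  have [->|xn0] := eqVneq x 0.
    by rewrite mem_set// memNset ?addr0//= in_itv/= ltxx.
  rewrite memNset; last by move=> /= x00; rewrite x00 eqxx in xn0.
  by rewrite add0r mem_set//= in_itv/= lt_neqAle eq_sym xn0 x0.
rewrite cintD//; last 2 first.
- exact: cintegrableS i0.
- exact: cintegrableS i1.
rewrite !cint_restrict0 cintZ; last 2 first.
- exact: measurableI.
- by apply: cintegrableS ih => //; exact: measurableI.
rewrite (_ : [set 0] `&` `[0, R0]%classic = [set 0]); last first.
  by apply/seteqP; split => x; [case|move=> /= ->; rewrite in_itv/= lexx].
rewrite -rhoE// rho0 mulr0 add0r; congr (cint m _ _).
apply/seteqP; split => x; [|case] => //=; rewrite !in_itv/= => /andP[x0 xR].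
by rewrite x0 xR ltW.
Qed.

End sufficiency.

(** * Integrals of powers and of resolvents *)

Lemma cintegral0 d (T : measurableType d) (R : realType) (nu : cmeasure T R) D :
  cintegral nu D (fun=> 0) = 0.
Proof.
by rewrite /cintegral /charge_integral /Rintegral/= !integral0_eq//= !(subr0, addr0).
Qed.

Lemma cintegralZ d (T : measurableType d) (R : realType) (nu : cmeasure T R) D
    (c : R[i]) (f : T -> R[i]) K :
  measurable D -> measurable_fun setT f ->
  (forall x, D x -> Normc.normc (f x) <= K) ->
  cintegral nu D (fun x => c * f x) = c * cintegral nu D f.
Proof.
move=> mD mf fK; have [m [h [ih nuE]]] := cmeasure_density nu.
have mh := cintegrable_measurable ih.
have ifh : cintegrable m D (fun x => f x * h x).
  by apply: bounded_cintegrable fK _ => //; exact: cintegrableS ih.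
rewrite (cintegral_density (phi := id) _ ih nuE mD mf)// -cintZ//.
rewrite (cintegral_density (phi := id) _ ih nuE mD (measurable_cplxM (measurable_cst c) mf))//.
  by apply: eq_cint => x _; rewrite mulrA.
by apply: eq_cintegrable (cintegrableZ c mD ifh) => // x _; rewrite mulrA.
Qed.

Section ray_sums.
Variables (R : realType) (M s : nat) (R0 : R).
Hypotheses (M_gt0 : (0 < M)%N) (R0_ge0 : 0 <= R0).
Variable rho : cmeasure R R.
Hypothesis rho_cond : radial_condition M s R0 rho.
Local Notation zeta := (zeta R M).

(** Summation over the rays is a projection onto the powers congruent to [s]. *)
Lemma sum_ray_expn n (x : R) :
  \sum_(r < M) zeta ^- (r * s) * (zeta ^+ r * (rootM M x)%:C) ^+ n =
  (if (n == s %[mod M])%N then M%:R else 0) * (rootM M x)%:C ^+ n.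
Proof.
rewrite -(sum_zeta R M_gt0) mulr_suml; apply: eq_bigr => r _.
by rewrite exprMn -exprM mulrA.
Qed.

Let measurable_expn n : measurable_fun setT (fun z : R[i] => z ^+ n).
Proof. by apply: measurable_cplxX; exact: measurable_id. Qed.

Let star_expn_bounded n z : star M R0 z -> Normc.normc (z ^+ n) <= rootM M R0 ^+ n.
Proof. exact: star_normcX. Qed.

Local Notation ray_lift f := (M%:R^-1 * \sum_(r < M) (zeta ^- (r * s) *
  cintegral rho (radial_dom s R0)
    (fun x => f (zeta ^+ r * (rootM M x)%:C) * (weight M s x)%:C))).

Lemma lift_expn_radial k :
  ray_lift (fun z => z ^+ (s + M * k)) = cintegral rho `[0, R0] (fun x => x%:C ^+ k).
Proof.
apply: (lift_value M_gt0 R0_ge0 rho_cond (f := fun z => z ^+ (s + M * k))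
  (G := fun x => x%:C ^+ k) (K' := R0 ^+ k) (measurable_expn _) (@star_expn_bounded _)).
- by apply: measurable_cplxX; exact: measurable_real_complex.
- by move=> x /andP[x0 xR]; rewrite normcX normc_real// lerXn2r// nnegrE.
- move=> x /radial_dom_itv[/andP[x0 _] _].
  rewrite sum_ray_expn -modnDmr modnMr addn0 eqxx exprD exprM.
  by rewrite -(rmorphXn _ M) /= rootMX.
Qed.

Lemma lift_expn_other n : n <> s %[mod M] -> ray_lift (fun z => z ^+ n) = 0.
Proof.
move=> /eqP/negbTE ns.
transitivity (cintegral rho `[0, R0] (fun=> 0)); last exact: cintegral0.
apply: (lift_value M_gt0 R0_ge0 rho_cond (f := fun z => z ^+ n)
  (G := fun=> 0) (K' := 0) (measurable_expn _) (@star_expn_bounded _)).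
- exact: measurable_cst.
- by move=> x _; rewrite Normc.normc0.
- by move=> x _; rewrite sum_ray_expn ns mul0r !mulr0.
Qed.

Lemma lift_resolvent lambda : (s < M)%N -> ~ star M R0 lambda ->
  ray_lift (fun z => (lambda - z)^-1) = lambda ^+ (M - s - 1) *
    cintegral rho `[0, R0] (fun x => (lambda ^+ M - x%:C)^-1).
Proof.
move=> sM nl; have [e e0 eP] := not_star_dist M_gt0 R0_ge0 nl.
have [K KP] := resolvent_bounded M_gt0 R0_ge0 nl.
have mg : measurable_fun setT (fun x : R => (lambda ^+ M - x%:C)^-1).
  apply: measurable_cplxV; apply: measurable_cplxB; first exact: measurable_cst.
  exact: measurable_real_complex.
have gK x : 0 <= x <= R0 -> Normc.normc (lambda ^+ M - x%:C)^-1 <= e^-1.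
  move=> x0R; rewrite Normc.normcV lef_pV2 ?posrE ?eP//.
  exact: lt_le_trans e0 (eP _ x0R).
rewrite -(@cintegralZ _ _ _ rho `[0, R0]%classic _ _ e^-1)//.
apply: (lift_value M_gt0 R0_ge0 rho_cond (f := fun z => (lambda - z)^-1)
  (G := fun x => lambda ^+ (M - s - 1) * (lambda ^+ M - x%:C)^-1)
  (K' := Normc.normc (lambda ^+ (M - s - 1)) * e^-1) _ KP).
- apply: measurable_cplxV; apply: measurable_cplxB; first exact: measurable_cst.
  exact: measurable_id.
- by apply: measurable_cplxM => //; exact: measurable_cst.
- by move=> x x0R; rewrite Normc.normcM ler_wpM2l ?normc_ge0 ?gK.
- move=> x /radial_dom_itv[x0R _]; rewrite (resolvent_sum M_gt0 R0_ge0 nl sM x0R).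
  by congr (_ * _); ring.
Qed.

End ray_sums.
Theorem proposition6p5 (R : realType) (p q : nat)
    (hp : (1 <= p)%N) (hq : (1 <= q)%N)
    (L U : nat -> imx R nat)
    (hL : forall k, (1 <= k <= p)%N -> norm_pos_lower (L k))
    (hU : forall k, (1 <= k <= q)%N -> norm_pos_upper (U k))
    (a : nat) (ha : (a_minus p q <= a <= a_plus p q)%N)
    (tF : seq (factor R))
    (htF : clos_refl_trans _ (@exchange R) (cyclic_factors p q L U a) tF)
    (htype : [seq F.1 | F <- tF] = sigma_min p q)
    (j i : nat) (hj : (j < q)%N) (hi : (i < p)%N)
    (R0 : R) (hR0 : 0 <= R0)
    (rho : cmeasure R R)
    (hrho : represents (fun x : R => x%:C) rho `[0, R0]
              (radial_functional p q tF j i)) :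
  let M := (p + q)%N in
  let s := shift p q j i in
  let Psi := Psi_functional p q tF j i in
  let Rad := radial_functional p q tF j i in
  let Sigma := star M R0 in
  ((exists nu : cmeasure R[i] R, represents id nu Sigma Psi) <->
   radial_condition M s R0 rho)
  /\
  (radial_condition M s R0 rho ->
   exists rhohat : cmeasure R[i] R,
   [/\ represents id rhohat Sigma Psi,
       (forall f : R[i] -> R[i],
          measurable_fun setT f ->
          (exists K : R, forall z, Sigma z -> `|f z| <= K%:C) ->
          cintegral rhohat Sigma f =
          M%:R^-1 * \sum_(r < M) (zeta R M ^- (r * s)
            * cintegral rho (radial_dom s R0)
                (fun x => f (zeta R M ^+ r * (rootM M x)%:C)
                          * (weight M s x)%:C))),
       (forall k : nat,
          cintegral rhohat Sigma (fun z => z ^+ (s + M * k)) = Rad 'X^k),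
       (forall n : nat, n <> s %[mod M] ->
          cintegral rhohat Sigma (fun z => z ^+ n) = 0)
     & (forall lambda : R[i], ~ Sigma lambda ->
          cintegral rhohat Sigma (fun z => (lambda - z)^-1) =
          lambda ^+ (M - s - 1)
          * cintegral rho `[0, R0] (fun x => (lambda ^+ M - x%:C)^-1))]).
Proof.
move=> M s Psi Rad Sigma.
have M_gt0 : (0 < M)%N by rewrite addn_gt0 hp.
have sM : (s < M)%N by exact: shift_lt.
have PsiX k : Psi 'X^(s + M * k) = Rad 'X^k 
  by rewrite /Psi /Psi_functional /Rad /radial_functional !moment_functionalXn.
have Psi0 n : n <> s %[mod M] -> Psi 'X^n = 0.
  by move=> ns; rewrite /Psi /Psi_functional moment_functionalXn; exact: Hpow_eq0.
have lift_ex : radial_condition M s R0 rho -> exists rhohat : cmeasure R[i] R,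
   [/\ represents id rhohat Sigma Psi,
       (forall f : R[i] -> R[i],
          measurable_fun setT f ->
          (exists K : R, forall z, Sigma z -> `|f z| <= K%:C) ->
          cintegral rhohat Sigma f =
          M%:R^-1 * \sum_(r < M) (zeta R M ^- (r * s)
            * cintegral rho (radial_dom s R0)
                (fun x => f (zeta R M ^+ r * (rootM M x)%:C)
                          * (weight M s x)%:C))),
       (forall k : nat,
          cintegral rhohat Sigma (fun z => z ^+ (s + M * k)) = Rad 'X^k),
       (forall n : nat, n <> s %[mod M] ->
          cintegral rhohat Sigma (fun z => z ^+ n) = 0)
     & (forall lambda : R[i], ~ Sigma lambda ->
          cintegral rhohat Sigma (fun z => (lambda - z)^-1) =
          lambda ^+ (M - s - 1)
          * cintegral rho `[0, R0] (fun x => (lambda ^+ M - x%:C)^-1))].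
  move=> rho_cond; have [rhohat [conc liftE]] := lift_exists M_gt0 hR0 rho_cond.
  have mX n : measurable_fun setT (fun z : R[i] => z ^+ n).
    by apply: measurable_cplxX; exact: measurable_id.
  have bX n : exists K, forall z, Sigma z -> Normc.normc (z ^+ n) <= K.
    by exists (rootM M R0 ^+ n) => z; exact: star_normcX.
  have momentE k : cintegral rhohat Sigma (fun z => z ^+ (s + M * k)) = Rad 'X^k.
    rewrite (liftE _ (mX _) (bX _)) (lift_expn_radial M_gt0 hR0 rho_cond).
    exact: hrho.2.
  have moment0 n : n <> s %[mod M] -> cintegral rhohat Sigma (fun z => z ^+ n) = 0.
    by move=> ns; rewrite (liftE _ (mX _) (bX _)) (lift_expn_other M_gt0 hR0 rho_cond ns).
  exists rhohat; split => //.
  - split => // n; have [ns|/eqP ns] := eqVneq (n %% M)%N (s %% M)%N; last first.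
      by rewrite (moment0 _ ns) Psi0.
    have -> : n = (s + M * (n %/ M))%N.
      by rewrite {1}(divn_eq n M) ns (modn_small sM) addnC mulnC.
    by rewrite momentE PsiX.
  - move=> f mf [K fK]; apply: liftE => //; exists K => z Sz.
    by rewrite -lecR; exact: fK.
  - move=> lambda nl; have [K KP] := resolvent_bounded M_gt0 hR0 nl.
    rewrite liftE; [|..]; last by exists K.
      exact: lift_resolvent.
    apply: measurable_cplxV; apply: measurable_cplxB; first exact: measurable_cst.
    exact: measurable_id.
split => //; split; last by move=> /lift_ex[rhohat [? _ _ _ _]]; exists rhohat.
by move=> [nu nuP]; exact: (radial_condition_necessary M_gt0 hR0 hrho nuP PsiX).
Qed.
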